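(* Let the Haar measure $dx$ on $Z\backslash G$ be normalized so that the volume of $Z\backslash ZK$ equals $1$. Then the formal degree of each of the representations $\sigma_\chi^+$ and $\sigma_\chi^-$ (where $\chi=\chi_{1,1,t}$, $t\in\mathfrak o^\times$, with trivial central character) with respect to $dx$ equals $\frac{(q^4-1)(q^2-1)}2$. In other words, for any vector $v$ in the space of $\sigma_\chi^\pm$, $$\frac{(q^4-1)(q^2-1)}{2}\int_{Z\backslash G}|\langle v,\sigma_\chi^\pm(x)v\rangle|^2\,dx=\langle v,v\rangle^2.$$
   Context: $F$ is a non-archimedean local field of characteristic zero with ring of integers $\mathfrak o$, maximal ideal $\mathfrak p$, uniformizer $\varpi$, $q=\#(\mathfrak o/\mathfrak p)$. $\psi$ is a character of $F$ trivial on $\mathfrak o$ but not on $\mathfrak p^{-1}$, and $\psi_0(x)=\psi(\varpi^{-1}x)$. $G=\mathrm{GSp}_4(F)=\{g\in\mathrm{GL}_4(F):{}^tgJg=\mu(g)J,\ \mu(g)\in F^\times\}$ with $J=\begin{bmatrix}&&&1\\&&1\\&-1\\-1\end{bmatrix}$; $Z$ is its center and $K=\mathrm{GSp}_4(\mathfrak o)$. Let $K'=G\cap\begin{bmatrix}1+\mathfrak p&\mathfrak o&\mathfrak o&\mathfrak o\\\mathfrak p&1+\mathfrak p&\mathfrak o&\mathfrak o\\\mathfrak p&\mathfrak p&1+\mathfrak p&\mathfrak o\\\mathfrak p&\mathfrak p&\mathfrak p&1+\mathfrak p\end{bmatrix}$ and $H=ZK'$. For $t\in\mathfrak o^\times$,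 $\chi=\chi_{1,1,t}:H\to\mathbb C^\times$ is $\chi(zk)=\psi_0(k_{12}+k_{23}+t\varpi^{-1}k_{41})$ for $z\in Z$, $k\in K'$. Let $g_\chi=\begin{bmatrix}0&0&1&0\\0&0&0&-1\\-\varpi/t&0&0&0\\0&\varpi/t&0&0\end{bmatrix}$, $H'=H\sqcup g_\chi H$, and $\chi^\pm:H'\to\mathbb C^\times$, $\chi^\pm(h)=\chi(h)$, $\chi^\pm(g_\chi h)=\pm\chi(h)$ for $h\in H$. Then $\sigma_\chi^\pm=\text{c-Ind}_{H'}^G(\chi^\pm)$, realized on smooth functions $f:G\to\mathbb C$, compactly supported modulo $Z$, with $f(hg)=\chi^\pm(h)f(g)$ for $h\in H'$, with $G$ acting by right translation; these are irreducible supercuspidal representations. The $G$-invariant inner product is $\langle f_1,f_2\rangle=\mathrm{vol}(Z\backslash H')^{-1}\int_{Z\backslash G}f_1(x)\overline{f_2(x)}\,dx$. *)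

(* Defs.v *)
From HB Require Import structures.
From mathcomp Require Import all_boot all_order all_algebra.
From mathcomp Require Import generic_quotient complex ring.
From mathcomp Require Import all_classical all_reals all_analysis.

Set Implicit Arguments.
Unset Strict Implicit.
Unset Printing Implicit Defensive.

Import Order.TTheory GRing.Theory Num.Theory.
Import numFieldNormedType.Exports.

Local Open Scope classical_set_scope.
Local Open Scope ring_scope.
Local Open Scope quotient_scope.
Local Open Scope complex_scope.

(* The fractional ideal p^n of a valuation v : F -> int; the value of v at 0 is
   irrelevant (0 belongs to every p^n by fiat). *)
Definition valuation_ideal (F : zmodType) (v : F -> int) (n : int) : set F :=
  [set x | x = 0 \/ n <= v x].

(* o / p, as the set of the cosets x + p with x in o. *)
Definition valuation_residues (F : zmodType) (v : F -> int) : set (set F) :=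
  [set [set y | valuation_ideal v 1 (y - x)] | x in valuation_ideal v 0].

(* A field of characteristic zero which is complete for a normalized discrete
   valuation with finite residue field, with the topology of that valuation. *)
HB.mixin Record isNonarchLocalField F of GRing.Field F & Topological F := {
  valuation : F -> int ;
  valuationM : forall x y : F, x != 0 -> y != 0 ->
    valuation (x * y) = valuation x + valuation y ;
  valuationD : forall x y : F, x != 0 -> y != 0 -> x + y != 0 ->
    Num.min (valuation x) (valuation y) <= valuation (x + y) ;
  valuation_normalized : exists x : F, x != 0 /\ valuation x = 1 ;
  nbhs_valuation : forall x : F,
    nbhs x = filter_from [set: int]
      (fun n => [set y | valuation_ideal valuation n (y - x)]) ;
  valuation_complete : forall u : nat -> F,
    (forall n : int, exists N : nat, forall i j : nat, (N <= i)%N -> (N <= j)%N ->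
       valuation_ideal valuation n (u i - u j)) ->
    exists l : F, u @ \oo --> l ;
  valuation_residues_finite : finite_set (valuation_residues valuation) ;
  local_pchar0 : [pchar F] =i pred0
}.

#[short(type="nonarchLocalFieldType")]
HB.structure Definition NonarchLocalField :=
  {F of GRing.Field F & Topological F & isNonarchLocalField F}.

Section LocalField.
Variable F : nonarchLocalFieldType.

Definition pideal (n : int) : set F := valuation_ideal (@valuation F) n.

Definition integers : set F := pideal 0.

Definition maxideal : set F := pideal 1.

Definition integer_units : set F := [set x | x != 0 /\ valuation x = 0].

Definition uniformizer (varpi : F) : Prop := varpi != 0 /\ valuation varpi = 1.

Definition residue_field : set (set F) := valuation_residues (@valuation F).

End LocalField.

Arguments pideal : clear implicits.
Arguments integers : clear implicits.
Arguments maxideal : clear implicits.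
Arguments integer_units : clear implicits.
Arguments residue_field : clear implicits.

Definition additive_character (R : realType) (F : nonarchLocalFieldType)
    (psi : F -> R[i]) : Prop :=
  [/\ forall x, psi x != 0,
      {morph psi : x y / x + y >-> x * y} &
      continuous (psi : F -> R[i]^o)].

Definition mx4 (F : nzRingType) (rows : seq (seq F)) : 'M[F]_4 :=
  \matrix_(i, j) nth 0 (nth [::] rows i) j.

Definition Jmx (F : nzRingType) : 'M[F]_4 :=
  mx4 [:: [:: 0;  0;  0; 1];
          [:: 0;  0;  1; 0];
          [:: 0; -1;  0; 0];
          [:: -1; 0;  0; 0]].

Definition is_gsp4 (F : fieldType) (g : 'M[F]_4) : bool :=
  (g \in unitmx) && `[< exists2 m : F, m != 0 & g^T *m Jmx F *m g = m *: Jmx F >].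

Record GSp4 (F : fieldType) : Type := MkGSp4 {
  gsp4_mx :> 'M[F]_4 ;
  gsp4_mxP : is_gsp4 gsp4_mx
}.

HB.instance Definition _ (F : fieldType) := [isSub for @gsp4_mx F].
HB.instance Definition _ (F : fieldType) := [Choice of GSp4 F by <:].

Section GSp4Group.
Variable F : fieldType.
Implicit Types g h : GSp4 F.

Lemma is_gsp4_1 : is_gsp4 (1%:M : 'M[F]_4).
Proof.
rewrite /is_gsp4 unitmx1; apply/asboolP; exists 1; first exact: oner_neq0.
by rewrite trmx1 mul1mx mulmx1 scale1r.
Qed.

Lemma is_gsp4_mul g h : is_gsp4 (g *m h : 'M[F]_4).
Proof.
case: g h => [g /= /andP[ug /asboolP[m m0 gm]]] [h /= /andP[uh /asboolP[n n0 hn]]].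
rewrite /is_gsp4 unitmx_mul ug uh /=; apply/asboolP; exists (m * n).
  by rewrite mulf_neq0.
rewrite trmx_mul -!mulmxA (mulmxA (Jmx F)) (mulmxA g^T) (mulmxA g^T) gm.
by rewrite -scalemxAl -scalemxAr mulmxA hn scalerA.
Qed.

Lemma is_gsp4_inv g : is_gsp4 (invmx g).
Proof.
case: g => [g /= /andP[ug /asboolP[m m0 gm]]].
rewrite /is_gsp4 unitmx_inv ug; apply/asboolP; exists m^-1.
  by rewrite invr_eq0.
have JE : Jmx F = m^-1 *: (g^T *m Jmx F *m g).
  by rewrite gm scalerA mulVf // scale1r.
rewrite {1}JE -scalemxAr -scalemxAl; congr (_ *: _).
by rewrite -!mulmxA mulmxV // mulmx1 mulmxA -trmx_mul mulmxV // trmx1 mul1mx.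
Qed.

Definition gsp4_one : GSp4 F := MkGSp4 is_gsp4_1.
Definition gsp4_mul g h : GSp4 F := MkGSp4 (is_gsp4_mul g h).
Definition gsp4_inv g : GSp4 F := MkGSp4 (is_gsp4_inv g).

Lemma gsp4_mulA : associative gsp4_mul.
Proof. by move=> g h k; apply: val_inj; rewrite /= mulmxA. Qed.

Lemma gsp4_mul1 : left_id gsp4_one gsp4_mul.
Proof. by move=> g; apply: val_inj; rewrite /= mul1mx. Qed.

Lemma gsp4_mulr1 : right_id gsp4_one gsp4_mul.
Proof. by move=> g; apply: val_inj; rewrite /= mulmx1. Qed.

Lemma gsp4_mulV : left_inverse gsp4_one gsp4_inv gsp4_mul.
Proof.
by move=> g; apply: val_inj; rewrite /= mulVmx //; case/andP: (gsp4_mxP g).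
Qed.

Lemma gsp4_mulrV : right_inverse gsp4_one gsp4_inv gsp4_mul.
Proof.
by move=> g; apply: val_inj; rewrite /= mulmxV //; case/andP: (gsp4_mxP g).
Qed.

End GSp4Group.

HB.instance Definition _ (F : fieldType) := isGroup.Build (GSp4 F)
  (@gsp4_mulA F) (@gsp4_mul1 F) (@gsp4_mulr1 F) (@gsp4_mulV F) (@gsp4_mulrV F).

HB.instance Definition _ (F : nonarchLocalFieldType) :=
  Topological.copy (GSp4 F) (initial_topology (@gsp4_mx F)).
HB.instance Definition _ (F : nonarchLocalFieldType) :=
  isPointed.Build (GSp4 F) 1%g.

Definition centerG (F : fieldType) : set (GSp4 F) :=
  [set z | forall g : GSp4 F, (z * g = g * z)%g].
Arguments centerG : clear implicits.

Section Quotient.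
Variable F : fieldType.

Definition eqmodZ : rel (GSp4 F) :=
  fun g h => `[< exists2 z, centerG F z & h = (z * g)%g >].

Lemma eqmodZ_refl : reflexive eqmodZ.
Proof.
move=> g; apply/asboolP; exists 1%g; last by rewrite mul1g.
by move=> h; rewrite mul1g mulg1.
Qed.

Lemma eqmodZ_sym : symmetric eqmodZ.
Proof.
suff H g h : eqmodZ g h -> eqmodZ h g by move=> g h; apply/idP/idP; apply: H.
move=> /asboolP[z Zz ->]; apply/asboolP; exists z^-1%g; last by rewrite mulKg.
by move=> k; apply: (mulgI z); rewrite mulVKg mulgA Zz mulgK.
Qed.

Lemma eqmodZ_trans : transitive eqmodZ.
Proof.
move=> h g k /asboolP[z Zz ->] /asboolP[w Zw ->]; apply/asboolP.
exists (w * z)%g; last by rewrite mulgA.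
by move=> x; rewrite -mulgA (Zz x) mulgA (Zw x) -mulgA.
Qed.

Canonical eqmodZ_equiv := EquivRel eqmodZ eqmodZ_refl eqmodZ_sym eqmodZ_trans.

End Quotient.

Definition ZG (F : nonarchLocalFieldType) : Type :=
  quotient_topology {eq_quot (@eqmodZ F)}.
HB.instance Definition _ (F : nonarchLocalFieldType) := PointedTopological.on (ZG F).
HB.instance Definition _ (F : nonarchLocalFieldType) := Quotient.on (ZG F).

Definition piZ (F : nonarchLocalFieldType) (g : GSp4 F) : ZG F := \pi_(ZG F) g.

Notation borelZG F := (g_sigma_algebraType (@open (ZG F))).

(* Z\G is unimodular and second countable: its Haar measures are invariant on
   both sides, and their regularity follows from finiteness on compact sets. *)
Definition haar_measure (R : realType) (F : nonarchLocalFieldType)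
    (mu : {measure set (borelZG F) -> \bar R}) : Prop :=
  [/\ forall A : set (ZG F), compact A -> (mu A < +oo)%E,
      forall (g : GSp4 F) (A : set (borelZG F)), measurable A ->
        mu [set piZ (g * repr x)%g | x in (A : set (ZG F))] = mu A &
      forall (g : GSp4 F) (A : set (borelZG F)), measurable A ->
        mu [set piZ (repr x * g)%g | x in (A : set (ZG F))] = mu A].

(* A Z-invariant function on G, as a function on Z\G. *)
Definition descend (F : nonarchLocalFieldType) (T : Type) (f : GSp4 F -> T) :
  borelZG F -> T := fun x => f (repr (x : ZG F)).

Definition integralC d (T : measurableType d) (R : realType)
    (mu : {measure set T -> \bar R}) (f : T -> R[i]) : R[i] :=
  (\int[mu]_x complex.Re (f x)) +i* (\int[mu]_x complex.Im (f x)).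

Section Characters.
Variables (R : realType) (F : nonarchLocalFieldType).
Variables (psi : F -> R[i]) (varpi t : F).

Definition Kmax : set (GSp4 F) :=
  [set g : GSp4 F | (forall i j, integers F (g i j)) /\ integer_units F (\det g)].

Definition Kprime : set (GSp4 F) :=
  [set g : GSp4 F | forall i j : 'I_4,
     if i == j then maxideal F (g i j - 1)
     else if (i < j)%N then integers F (g i j)
     else maxideal F (g i j)].

Definition mulset (A B : set (GSp4 F)) : set (GSp4 F) :=
  [set g | exists a b, [/\ A a, B b & g = (a * b)%g]].

Definition Hgrp : set (GSp4 F) := mulset (centerG F) Kprime.

Definition psi0 (x : F) : R[i] := psi (varpi^-1 * x).

(* chi (z k) for z in Z and k in K'; the value does not depend on the choice of
   z and k, since k is determined up to the scalars in 1 + p. *)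
Definition chi (h : GSp4 F) : R[i] :=
  let zk := xget (1%g, 1%g)
    [set zk | [/\ centerG F zk.1, Kprime zk.2 & h = (zk.1 * zk.2)%g]] in
  let k := zk.2 in
  psi0 (k 0 1 + k 1 2 + t * varpi^-1 * k 3 0).

Definition gchi_mx : 'M[F]_4 :=
  mx4 [:: [:: 0;           0;         1; 0];
          [:: 0;           0;         0; -1];
          [:: - (varpi / t); 0;         0; 0];
          [:: 0;           varpi / t; 0; 0]].

Lemma gchi_mxP : varpi != 0 -> t != 0 -> is_gsp4 gchi_mx.
Proof.
move=> w0 t0; have c0 : varpi / t != 0 by rewrite mulf_neq0 ?invr_eq0.
have := c0; rewrite /is_gsp4 /gchi_mx; set c := varpi / t => _.
apply/andP; split.
  set g := mx4 _; suff /mulmx1_unit[] : g *m (- c^-1 *: g) = 1%:M by [].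
  apply/matrixP => i j; rewrite -scalemxAr !mxE !big_ord_recl big_ord0 /= !mxE.
  case: i => [[|[|[|[|//]]]] ?]; case: j => [[|[|[|[|//]]]] ?] /=;
  by rewrite ?mxE /=; field.
apply/asboolP; exists (- c); first by rewrite oppr_eq0.
apply/matrixP => i j.
rewrite !mxE !big_ord_recl big_ord0 /= !mxE !big_ord_recl !big_ord0 /= !mxE.
case: i => [[|[|[|[|//]]]] ?]; case: j => [[|[|[|[|//]]]] ?] /=;
by rewrite ?mxE /=; ring.
Qed.

(* The element of G with matrix gchi_mx (see gchi_mxP). *)
Definition gchi : GSp4 F := insubd (1%g : GSp4 F) gchi_mx.

Definition Hprime : set (GSp4 F) :=
  Hgrp `|` [set (gchi * h)%g | h in Hgrp].

(* chi^+ for s = false and chi^- for s = true; only its values on H' matter. *)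
Definition chi_pm (s : bool) (h : GSp4 F) : R[i] :=
  if `[< Hgrp h >] then chi h else (-1) ^+ s * chi (gchi^-1 * h)%g.

End Characters.

Section Representation.
Variables (R : realType) (F : nonarchLocalFieldType).
Variable mu : {measure set (borelZG F) -> \bar R}.

Definition smooth (f : GSp4 F -> R[i]) : Prop :=
  forall g, \forall x \near g, f x = f g.

Definition compact_support_modZ (f : GSp4 F -> R[i]) : Prop :=
  exists2 C : set (ZG F), compact C & forall g, f g != 0 -> C (piZ g).

Definition cInd (S : set (GSp4 F)) (theta : GSp4 F -> R[i]) :
    set (GSp4 F -> R[i]) :=
  [set f | [/\ smooth f, compact_support_modZ f &
     forall h g, S h -> f (h * g)%g = theta h * f g]].

Definition right_translation (x : GSp4 F) (f : GSp4 F -> R[i]) : GSp4 F -> R[i] :=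
  fun g => f (g * x)%g.

Definition inner (S : set (GSp4 F)) (f1 f2 : GSp4 F -> R[i]) : R[i] :=
  ((fine (mu (@piZ F @` S)))^-1)%:C *
  integralC mu (descend (fun x => f1 x * (f2 x)^*)).

(* V is assumed to have trivial central character, so that |<v, x v>|^2 is a
   function of the class of x in Z\G; its integrability excludes the junk value
   of Rintegral. *)
Definition is_formal_degree (V : set (GSp4 F -> R[i]))
    (ip : (GSp4 F -> R[i]) -> (GSp4 F -> R[i]) -> R[i]) (d : R) : Prop :=
  forall v, V v ->
    let coeff := descend (fun x => Normc.normc (ip v (right_translation x v)) ^+ 2) in
    mu.-integrable setT (fun x => (coeff x)%:E) /\
    (d * \int[mu]_x coeff x)%:C = ip v v ^+ 2.

End Representation.

(* Main.v *)
(* Writing [V] for the induced space and [H'] for the inducing subgroup, the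
   coefficient [<v, x v>] of [v] in [V] is the finite sum of the
   [v(a) (v(a x))^*] over representatives [a] of the cosets of [H'] in the
   support of [v].  Expanding its square modulus and using left invariance,
   its integral becomes a combination of the values at [b a^-1] of
   [Phi(y) = \int v(y x) (v x)^* dx].  Translating the variable by [k] shows
   that [Phi(y) = 0] as soon as some [k] in [H'] has [y k y^-1] in [H'] and
   [chi (y k y^-1) <> chi k]; if this happens for every [y] outside [H'], only
   the diagonal terms survive, and the formal degree is [1 / vol(Z\H')].

   Such a [k] is found by reduction to a monomial [y], since
   [G = K' N(T) K'] by Gaussian elimination: a monomial [y] which intertwines
   [chi] maps every affine simple root to a simple or to a negative one, and as
   a positive combination of the simple roots is constant, it must permute
   them; it is then diagonal up to [gchi], and the values of [chi] on the simple
   root groups force it into [H'].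

   Finally [K / Z(o) K'] has [(q^4 - 1) (q^2 - 1)] elements: a coset is
   determined modulo [p] by the line of the first column, the second column
   modulo the first one, and the multiplier, for which there are respectively
   [(q^4 - 1) / (q - 1)], [q^2 - 1] and [q - 1] choices. *)
Require Import Defs.
From HB Require Import structures.
From mathcomp Require Import all_boot all_order all_algebra.
From mathcomp Require Import generic_quotient complex.
From mathcomp Require Import all_classical all_reals all_analysis.
From mathcomp Require Import measurable_realfun ring lra zify.
Import Order.TTheory GRing.Theory Num.Theory.
Import numFieldNormedType.Exports.
Local Open Scope classical_set_scope.
Local Open Scope card_scope.
Local Open Scope ring_scope.

Set Implicit Arguments.
Unset Strict Implicit.
Unset Printing Implicit Defensive.

(** * The valuation *)

(** The additive character is assumed continuous and non-vanishing, not unitary. Unitarity of chi,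
    which the cancellation and the bounds on vectors rest on, comes from the finite residue field:
    some positive integer n lies in p, so the values of [psi0] on o are n-th roots of unity.

    Membership in K' and triviality of chi are both read from exponents of p attached to matrix
    positions ([wt], [cwt]), so that conjugation by a monomial matrix becomes a system of integer
    inequalities.

    The two invariances of dx do different work. Left invariance moves the variable inside the
    integrals and gives the translates of H in ZK equal volume. Right invariance gives all cosets
    H'a the volume of H', which is why this volume cancels in the inner product.

    Lebesgue integrals of non-integrable functions carry default values, so every manipulation is
    confined to a class ([admissible]) on which integrability is automatic.

    The denominator 2 of the degree is the index of H in H': the volume of H is the inverse of (q^4
    - 1)(q^2 - 1), and that of H' is twice as large. *)

Section ValuationIdeals.
Variable F : nonarchLocalFieldType.
Implicit Types (x y : F) (n m : int).

Lemma valuation1 : valuation (1 : F) = 0.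
Proof.
have n0 : (1 : F) != 0 by apply: oner_neq0.
by have := valuationM _ _ n0 n0; rewrite mulr1; lia.
Qed.

Lemma valuationN x : x != 0 -> valuation (- x) = valuation x.
Proof.
move=> x0; have n0 : (- 1 : F) != 0 by rewrite oppr_eq0 oner_neq0.
have := valuationM _ _ n0 n0; rewrite mulrNN mulr1 valuation1 => h.
by rewrite -mulN1r valuationM //; lia.
Qed.

Lemma valuationV x : x != 0 -> valuation x^-1 = - valuation x.
Proof.
move=> x0; have xV0 : x^-1 != 0 by rewrite invr_eq0.
by have := valuationM _ _ x0 xV0; rewrite mulfV // valuation1; lia.
Qed.

Lemma pideal0 n : pideal F n 0.
Proof. by left. Qed.

Lemma pideal_neq0 n x : x != 0 -> pideal F n x = (n <= valuation x) :> Prop.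
Proof.
move=> x0; apply/propext; split=> [[x00|//]|h]; last by right.
by rewrite x00 eqxx in x0.
Qed.

Lemma pidealN n x : pideal F n x -> pideal F n (- x).
Proof.
have [->|x0] := eqVneq x 0; first by rewrite oppr0.
by rewrite !pideal_neq0 ?oppr_eq0 // valuationN.
Qed.

Lemma pidealD n x y : pideal F n x -> pideal F n y -> pideal F n (x + y).
Proof.
have [->|x0] := eqVneq x 0; first by rewrite add0r.
have [->|y0] := eqVneq y 0; first by rewrite addr0.
have [->|xy0] := eqVneq (x + y) 0; first by move=> _ _; apply: pideal0.
rewrite !pideal_neq0 // => nx ny.
by apply: le_trans (valuationD _ _ x0 y0 xy0); rewrite le_min nx.
Qed.

Lemma pidealB n x y : pideal F n x -> pideal F n y -> pideal F n (x - y).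
Proof. by move=> nx ny; apply: pidealD => //; apply: pidealN. Qed.

Lemma pidealM n m x y :
  pideal F n x -> pideal F m y -> pideal F (n + m) (x * y).
Proof.
have [->|x0] := eqVneq x 0; first by rewrite mul0r => _ _; apply: pideal0.
have [->|y0] := eqVneq y 0; first by rewrite mulr0 => _ _; apply: pideal0.
by rewrite !pideal_neq0 ?mulf_neq0 // valuationM // => *; apply: lerD.
Qed.

Lemma pideal_le n m x : n <= m -> pideal F m x -> pideal F n x.
Proof. by move=> nm [->|mx]; [left|right; apply: le_trans mx]. Qed.

Lemma pideal_sum n (I : Type) (r : seq I) (P : pred I) (f : I -> F) :
  (forall i, P i -> pideal F n (f i)) -> pideal F n (\sum_(i <- r | P i) f i).
Proof.
by move=> h; elim/big_ind: _ => //; [apply: pideal0|move=> x y; apply: pidealD].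
Qed.

Lemma pideal_exists x : exists n, pideal F n x.
Proof. by exists (valuation x); right. Qed.

Lemma integers1 : integers F 1.
Proof. by right; rewrite valuation1. Qed.

Lemma integersM x y : integers F x -> integers F y -> integers F (x * y).
Proof. by move=> ox oy; rewrite /integers -[0]addr0; apply: pidealM. Qed.

Lemma maxideal_integers x : maxideal F x -> integers F x.
Proof. exact: pideal_le. Qed.

Lemma maxidealMl x y : integers F x -> maxideal F y -> maxideal F (x * y).
Proof. by move=> ox py; rewrite /maxideal -[1]add0r; apply: pidealM. Qed.

Lemma maxidealMr x y : maxideal F x -> integers F y -> maxideal F (x * y).
Proof. by move=> px oy; rewrite mulrC; apply: maxidealMl. Qed.

Lemma unit_integers x : integer_units F x -> integers F x.
Proof. by move=> [_ x0]; right; rewrite x0. Qed.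

Lemma unit_neq0 x : integer_units F x -> x != 0.
Proof. by case. Qed.

Lemma unit1 : integer_units F 1.
Proof. by split; [apply: oner_neq0 | apply: valuation1]. Qed.

Lemma unitM x y : integer_units F x -> integer_units F y ->
  integer_units F (x * y).
Proof.
move=> [x0 vx] [y0 vy]; split; first by rewrite mulf_neq0.
by rewrite valuationM // vx vy.
Qed.

Lemma unitV x : integer_units F x -> integer_units F x^-1.
Proof.
by move=> [x0 vx]; split; [rewrite invr_eq0 | rewrite valuationV // vx].
Qed.

Lemma unit_notin_maxideal x :
  integers F x -> ~ maxideal F x -> integer_units F x.
Proof.
have [->|x0] := eqVneq x 0; first by move=> _ []; apply: pideal0.
rewrite /integers /maxideal !pideal_neq0 // => h1 h2; split => //; lia.
Qed.

Lemma maxideal_unit x : integer_units F x -> ~ maxideal F x.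
Proof. by move=> [x0 vx]; rewrite /maxideal pideal_neq0 // vx. Qed.

Lemma unit_1D x : maxideal F x -> integer_units F (1 + x).
Proof.
move=> px; apply: unit_notin_maxideal.
  by apply: pidealD; [apply: integers1|apply: maxideal_integers].
move=> p1x; apply: (maxideal_unit unit1).
by rewrite -(addrK x 1); apply: pidealB.
Qed.

Lemma one_units_unit x : maxideal F (x - 1) -> integer_units F x.
Proof. by move=> /unit_1D; rewrite addrC subrK. Qed.

Lemma one_unitsM x y :
  maxideal F (x - 1) -> maxideal F (y - 1) -> maxideal F (x * y - 1).
Proof.
move=> px py; rewrite (_ : x * y - 1 = (x - 1) * y + (y - 1)); last by ring.
apply: pidealD => //; apply: maxidealMr => //.
exact/unit_integers/one_units_unit.
Qed.

Lemma one_unitsV x : maxideal F (x - 1) -> maxideal F (x^-1 - 1).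
Proof.
move=> px; have ux := one_units_unit px.
rewrite (_ : x^-1 - 1 = x^-1 * - (x - 1)); last by field; apply: unit_neq0.
by apply: maxidealMl; [exact/unit_integers/unitV | apply: pidealN].
Qed.

Lemma maxideal_mul_unit x y :
  integer_units F x -> maxideal F (x * y) -> maxideal F y.
Proof.
move=> ux pxy; rewrite -(mulKf (unit_neq0 ux) y).
by apply: maxidealMl => //; apply/unit_integers/unitV.
Qed.

End ValuationIdeals.

(** * Symplectic similitudes *)

Lemma I4P (P : 'I_4 -> Prop) : P 0 -> P 1 -> P 2 -> P 3 -> forall i, P i.
Proof.
move=> p0 p1 p2 p3; case=> [[|[|[|[|//]]]] h].
- by have -> : Ordinal h = 0 by apply: val_inj.
- by have -> : Ordinal h = 1 by apply: val_inj.
- by have -> : Ordinal h = 2 by apply: val_inj.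
- by have -> : Ordinal h = 3 by apply: val_inj.
Qed.

Lemma sum4 (V : nmodType) (f : 'I_4 -> V) :
  \sum_i f i = f 0 + f 1 + f 2 + f 3.
Proof.
rewrite !big_ord_recl big_ord0 addr0 !addrA.
by congr (f _ + f _ + f _ + f _); apply: val_inj.
Qed.

Lemma rev4E : (rev_ord 0 = 3 :> 'I_4) * (rev_ord 1 = 2 :> 'I_4) *
  (rev_ord 2 = 1 :> 'I_4) * (rev_ord 3 = 0 :> 'I_4).
Proof. by do !split; apply: val_inj. Qed.

Section Similitude.
Variable F : fieldType.
Implicit Types g h z : GSp4 F.

(** The multiplier mu(g), read at a position where J has the entry 1. *)
Definition simil (g : GSp4 F) : F := (g^T *m Jmx F *m g) 0 3.

Lemma JmxV : (Jmx F)^T *m Jmx F = 1%:M.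
Proof.
by apply/matrixP; apply: I4P; apply: I4P; rewrite !mxE sum4 !mxE /=; ring.
Qed.

Lemma similP g : g^T *m Jmx F *m g = simil g *: Jmx F.
Proof.
rewrite /simil; case: g => [g /= /andP[ug /asboolP[m m0 gm]]].
by rewrite gm !mxE /= mulr1.
Qed.

Lemma simil_neq0 g : simil g != 0.
Proof.
rewrite /simil; case: g => [g /= /andP[ug /asboolP[m m0 gm]]].
by rewrite gm !mxE /= mulr1.
Qed.

Lemma simil_unique g m : g^T *m Jmx F *m g = m *: Jmx F -> simil g = m.
Proof. by rewrite /simil => ->; rewrite !mxE /= mulr1. Qed.

Lemma similM g h : simil (g * h)%g = simil g * simil h.
Proof.
apply: simil_unique; rewrite /= trmx_mul -!mulmxA (mulmxA (Jmx F)).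
rewrite (mulmxA g^T) (mulmxA g^T) similP -scalemxAl -scalemxAr.
by rewrite (mulmxA _ (Jmx F)) similP scalerA.
Qed.

Lemma is_gsp4_intro (M : 'M[F]_4) m :
  m != 0 -> M^T *m Jmx F *m M = m *: Jmx F -> is_gsp4 M.
Proof.
move=> m0 hM; apply/andP; split; last by apply/asboolP; exists m.
suff /mulmx1_unit[] : (m^-1 *: ((Jmx F)^T *m M^T *m Jmx F)) *m M = 1%:M by [].
by rewrite -scalemxAl -!mulmxA (mulmxA M^T) hM -scalemxAr scalerA mulVf //
  scale1r JmxV.
Qed.

(** As J^T J = 1, the relation g^T J g = mu(g) J exhibits a left inverse. The entries of the inverse
    are entries of g up to sign and multiplier, so its integrality needs no cofactors. *)
Lemma gsp4_invE g :
  (g^-1)%g = (simil g)^-1 *: ((Jmx F)^T *m g^T *m Jmx F) :> 'M[F]_4.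
Proof.
have gg : ((simil g)^-1 *: ((Jmx F)^T *m g^T *m Jmx F)) *m g = 1%:M.
  rewrite -scalemxAl -!mulmxA (mulmxA g^T) similP -scalemxAr scalerA.
  by rewrite mulVf ?simil_neq0 // scale1r JmxV.
have /andP[ug _] := gsp4_mxP g.
by rewrite -[RHS]mulmx1 -(mulmxV ug) mulmxA gg mul1mx.
Qed.

Definition eps (i : 'I_4) : F := if (i < 2)%N then 1 else -1.

Lemma gsp4_invij g i j :
  (g^-1)%g i j = (simil g)^-1 * (eps i * eps j * g (rev_ord j) (rev_ord i)).
Proof.
have -> : (g^-1)%g i j =
    ((simil g)^-1 *: ((Jmx F)^T *m g^T *m Jmx F)) i j by rewrite -gsp4_invE.
rewrite mxE; congr (_ * _); rewrite !mxE sum4 !mxE !sum4 !mxE.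
by elim/I4P: i; elim/I4P: j; rewrite /eps /= ?rev4E; ring.
Qed.

Lemma gsp4_col g i j :
  g 0 i * g 3 j + g 1 i * g 2 j - g 2 i * g 1 j - g 3 i * g 0 j =
  simil g * Jmx F i j.
Proof.
have := congr1 (fun M : 'M[F]_4 => M i j) (similP g).
by rewrite !mxE sum4 !mxE !sum4 !mxE /= => <-; ring.
Qed.

(** The transposed relation g J^T g^T = mu(g) J^T, obtained from g g^-1 = 1 and the formula for the
    inverse. *)
Lemma gsp4_row g i j :
  g i 0 * g j 3 + g i 1 * g j 2 - g i 2 * g j 1 - g i 3 * g j 0 =
  simil g * Jmx F i j.
Proof.
have gV : (g : 'M[F]_4) *m (g^-1)%g = 1%:M.
  by rewrite -[LHS]/(val (g * g^-1)%g) mulgV.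
have JJ : Jmx F *m (Jmx F)^T = 1%:M by rewrite (mulmx1C JmxV).
have : (g : 'M[F]_4) *m (Jmx F)^T *m g^T = simil g *: (Jmx F)^T.
  have {}gV : (g : 'M[F]_4) *m (Jmx F)^T *m g^T *m Jmx F = simil g *: 1%:M.
    rewrite -gV gsp4_invE -scalemxAr scalerA divff ?simil_neq0 // scale1r.
    by rewrite !mulmxA.
  by rewrite -[LHS]mulmx1 -JJ mulmxA gV -scalemxAl mul1mx.
move/(congr1 (fun M : 'M[F]_4 => - M i j)).
rewrite !mxE sum4 !mxE !sum4 !mxE /= => h.
transitivity (- (simil g * nth 0 (nth [::] [:: [:: 0;  0;  0; 1];
  [:: 0;  0;  1; 0]; [:: 0; -1;  0; 0]; [:: -1; 0;  0; 0]] j) i)); last first.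
  by elim/I4P: i {h}; elim/I4P: j => /=; ring.
by rewrite -h; ring.
Qed.

Lemma gsp4_mulE g h i j : (g * h)%g i j = \sum_k g i k * h k j.
Proof. by rewrite /= mxE. Qed.

Lemma gsp4_oneE i j : (1 : GSp4 F)%g i j = (i == j)%:R.
Proof. by rewrite /= mxE. Qed.

Lemma gsp4P g h : (forall i j, g i j = h i j) -> g = h.
Proof. by move=> e; apply: val_inj; apply/matrixP. Qed.

Lemma scalar_mulE z (c : F) g : (forall i j, z i j = c * (i == j)%:R) ->
  forall i j, (z * g)%g i j = c * g i j.
Proof.
by move=> zE i j; rewrite gsp4_mulE sum4 !zE; elim/I4P: i => /=; ring.
Qed.

Lemma simil_scalar z (c : F) : (forall i j, z i j = c * (i == j)%:R) ->
  simil z = c ^+ 2.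
Proof.
move=> zE; have := gsp4_col z 0 3; rewrite [Jmx F 0 3]mxE !zE /= => e.
by rewrite -[LHS]mulr1 -e; ring.
Qed.

Lemma scalar_mulVE z (c : F) g : c != 0 ->
  (forall i j, z i j = c * (i == j)%:R) ->
  forall i j, (z^-1 * g)%g i j = g i j / c.
Proof.
move=> c0 zE i j; apply: (mulfI c0); rewrite mulrCA divff // mulr1.
by rewrite -(scalar_mulE _ zE) mulVKg.
Qed.

Lemma simil1 : simil (1%g : GSp4 F) = 1.
Proof. by apply: simil_unique; rewrite /= trmx1 mul1mx mulmx1 scale1r. Qed.

(* Maps the [r]-th basis vector to [v], normalized by [v r = 1], and fixes the
   dual basis vector. *)
Definition unip_mx (r : 'I_4) (v : 'I_4 -> F) : 'M[F]_4 :=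
  \matrix_(a, b)
    if b == r then (if a == r then 1 else v a)
    else if a == rev_ord r then
      (if b == rev_ord r then 1 else eps b * eps r * v (rev_ord b))
    else (a == b)%:R.

Lemma unip_mxP r v :
  (unip_mx r v)^T *m Jmx F *m unip_mx r v = 1 *: Jmx F.
Proof.
apply/matrixP => i j; rewrite !mxE sum4 !mxE !sum4 !mxE /eps.
by elim/I4P: r; elim/I4P: i; elim/I4P: j;
   rewrite ?rev4E /= ?rev4E /=; ring.
Qed.

Definition unip r v : GSp4 F :=
  MkGSp4 (is_gsp4_intro (oner_neq0 F) (unip_mxP r v)).

Lemma simil_unip r v : simil (unip r v) = 1.
Proof. by apply: simil_unique; apply: unip_mxP. Qed.

End Similitude.
Arguments eps {F}.

(** * The group K' *)

Section ProUnipotent.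
Variable F : nonarchLocalFieldType.
Implicit Types (g h k z : GSp4 F) (i j : 'I_4).
Local Open Scope ring_scope.

(** K' consists of the 1 + X in G with X i j in p^(wt i j). The triangle inequality for [wt] makes
    this lattice stable under products, and its symmetry under [rev_ord] gives stability under
    inverses. *)
Definition wt (i j : 'I_4) : int := if (i < j)%N then 0 else 1.

Lemma wt_rev i j : wt (rev_ord i) (rev_ord j) = wt j i.
Proof. by elim/I4P: i; elim/I4P: j. Qed.

Lemma wt_ge0 i j : 0 <= wt i j.
Proof. by rewrite /wt; case: ifP. Qed.

Lemma wt_le1 i j : wt i j <= 1.
Proof. by rewrite /wt; case: ifP. Qed.

Lemma wt_triangle i j l : wt i j <= wt i l + wt l j.
Proof. by elim/I4P: i; elim/I4P: j; elim/I4P: l. Qed.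

Lemma KprimeP g :
  Kprime g <-> forall i j, pideal F (wt i j) (g i j - (i == j)%:R).
Proof.
split=> h i j; have := h i j; rewrite /wt.
  by case: eqP => [->|_]; rewrite ?ltnn // subr0; case: ifP.
by case: eqP => [->|_]; rewrite ?ltnn // subr0; case: ifP.
Qed.

Lemma Kprime_off g i j : Kprime g -> i != j -> pideal F (wt i j) (g i j).
Proof. by move=> /KprimeP/(_ i j) + /negPf ij; rewrite ij subr0. Qed.

Lemma Kprime_diag g i : Kprime g -> maxideal F (g i i - 1).
Proof. by move=> /KprimeP/(_ i i); rewrite eqxx /wt ltnn. Qed.

Lemma Kprime_integers g i j : Kprime g -> integers F (g i j).
Proof.
move=> kg; have [->|ij] := eqVneq i j.
  exact/unit_integers/one_units_unit/Kprime_diag.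
exact: pideal_le (wt_ge0 i j) (Kprime_off kg ij).
Qed.

Lemma Kprime_low g i j : Kprime g -> (j < i)%N -> maxideal F (g i j).
Proof.
move=> kg ji; have ij : i != j by rewrite neq_ltn ji orbT.
by have := Kprime_off kg ij; rewrite /wt ltnNge ltnW.
Qed.

Lemma Kprime1 : Kprime (1%g : GSp4 F).
Proof.
by apply/KprimeP => i j; rewrite gsp4_oneE subrr; apply: pideal0.
Qed.

Lemma gsp4_mul_sub1 g h i j :
  (g * h)%g i j - (i == j)%:R =
  (g i j - (i == j)%:R) + (h i j - (i == j)%:R) +
  \sum_l (g i l - (i == l)%:R) * (h l j - (l == j)%:R).
Proof. by rewrite gsp4_mulE !sum4; elim/I4P: i; elim/I4P: j => /=; ring. Qed.

Lemma KprimeM g h : Kprime g -> Kprime h -> Kprime (g * h)%g.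
Proof.
move=> /KprimeP kg /KprimeP kh; apply/KprimeP => i j.
rewrite gsp4_mul_sub1; apply: pidealD; first exact: pidealD.
apply: pideal_sum => l _; apply: pideal_le (wt_triangle i j l) _.
exact: pidealM.
Qed.

(** The multiplier is the pairing of columns 0 and 3; modulo p only the product of the two diagonal
    entries survives. *)
Lemma simil_Kprime g : Kprime g -> maxideal F (simil g - 1).
Proof.
move=> kg; have := gsp4_col g 0 3; rewrite !mxE /= mulr1 => <-.
rewrite (_ : _ - 1 = (g 0 0 * g 3 3 - 1) + g 1 0 * g 2 3
   - g 2 0 * g 1 3 - g 3 0 * g 0 3); last by ring.
have kk := Kprime_integers _ _ kg.
apply: pidealB; last by apply: maxidealMr => //; apply: Kprime_low.
apply: pidealB; last by apply: maxidealMr => //; apply: Kprime_low.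
apply: pidealD; last by apply: maxidealMr => //; apply: Kprime_low.
by apply: one_unitsM; apply: Kprime_diag.
Qed.

Lemma KprimeV g : Kprime g -> Kprime (g^-1)%g.
Proof.
move=> kg; have um := one_unitsV (simil_Kprime kg).
have iu := unit_integers (one_units_unit um).
apply/KprimeP => i j; rewrite gsp4_invij.
have [->|ij] := eqVneq i j.
  rewrite /wt ltnn; have -> : (eps j * eps j : F) = 1.
    by rewrite /eps; case: ifP => _; rewrite ?mulr1 ?mulrNN ?mulr1.
  by rewrite mul1r; apply: one_unitsM => //; apply: Kprime_diag.
rewrite subr0 mulrA -[wt i j]add0r; apply: pidealM.
  rewrite -[0]add0r; apply: pidealM => //; rewrite /eps.
  by do 2!case: ifP => _; rewrite ?mulr1 ?mulrN1 ?opprK;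
     do ?apply: pidealN; apply: integers1.
rewrite -(wt_rev j i); apply: Kprime_off => //.
by rewrite (inj_eq rev_ord_inj) eq_sym.
Qed.

Lemma centerGP z :
  centerG F z <-> exists2 c, c != 0 & forall i j, z i j = c * (i == j)%:R.
Proof.
split=> [cz|[c c0 zc] g]; last first.
  apply: gsp4P => i j; rewrite !gsp4_mulE !sum4 !zc.
  by elim/I4P: i; elim/I4P: j => /=; ring.
have zu r v i j := congr1 (fun g : GSp4 F => g i j) (cz (unip r v)).
have zE i j r v : \sum_l z i l * unip r v l j = \sum_l unip r v i l * z l j.
  by have := zu r v i j; rewrite !gsp4_mulE.
(* Commutation with a long root element, the identity plus one entry at (rev r, r), kills the
   off-diagonal entries of column [rev_ord r]. *)
have zr r i : i != rev_ord r -> z i (rev_ord r) = 0.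
  move=> ir; have := zE i r r (fun a => if a == rev_ord r then 1 else 0).
  rewrite !sum4 !mxE; move: ir.
  elim/I4P: r; elim/I4P: i => // _; rewrite ?rev4E /=;
  by move=> /eqP; rewrite -subr_eq0 => /eqP e; apply: etrans e; ring.
have off i j : i != j -> z i j = 0.
  by move=> ij; rewrite -(rev_ordK j); apply: zr; rewrite rev_ordK.
(* Commutation with the root element having entry 1 at (i, r) compares the two diagonal entries. *)
have zd r i : i != r -> z i i = z r r.
  move=> ir; have := zE i r r (fun a => if a == i then 1 else 0).
  rewrite !sum4 !mxE; move: ir.
  elim/I4P: r; elim/I4P: i => // _; rewrite ?rev4E /=;
  rewrite ?[z 0 1]off ?[z 0 2]off ?[z 0 3]off ?[z 1 0]off ?[z 1 2]off
   ?[z 1 3]off ?[z 2 0]off ?[z 2 1]off ?[z 2 3]off ?[z 3 0]off ?[z 3 1]off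
   ?[z 3 2]off // => /eqP; rewrite -subr_eq0 => /eqP e; apply/eqP;
  rewrite -subr_eq0; apply/eqP; apply: etrans e; ring.
exists (z 0 0) => [|i j].
  apply/eqP => z0; have := simil_neq0 z; have := gsp4_col z 0 3.
  rewrite !mxE /= mulr1 => <-; rewrite z0 [z 1 0]off // [z 2 0]off //.
  by rewrite [z 3 0]off // !mul0r !subr0 addr0 eqxx.
have [<-|ij] := eqVneq i j; last by rewrite mulr0; apply: off.
by rewrite mulr1; have [->//|i0] := eqVneq i 0; apply: zd.
Qed.

Lemma center1 : centerG F 1%g.
Proof. by move=> g; rewrite mul1g mulg1. Qed.

Lemma centerM z g : centerG F z -> centerG F g -> centerG F (z * g)%g.
Proof. by move=> cz cg h; rewrite -mulgA cg !mulgA cz. Qed.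

Lemma centerV z : centerG F z -> centerG F (z^-1)%g.
Proof. by move=> cz h; apply: (mulgI z); rewrite mulVKg mulgA cz mulgK. Qed.

Lemma scalar_mxP (c : F) : c != 0 ->
  (c%:M)^T *m Jmx F *m (c%:M) = (c ^+ 2) *: Jmx F.
Proof.
by move=> c0; rewrite tr_scalar_mx mul_scalar_mx mul_mx_scalar scalerA expr2.
Qed.

Lemma center_scalar (c : F) : c != 0 ->
  exists2 z, centerG F z & forall i j, z i j = c * (i == j)%:R.
Proof.
move=> c0; have c20 : c ^+ 2 != 0 by rewrite expf_neq0.
exists (MkGSp4 (is_gsp4_intro c20 (scalar_mxP c0))) => [|i j]; last first.
  by rewrite /= mxE mulr_natr.
apply/centerGP; exists c => // i j.
by rewrite /= mxE mulr_natr.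
Qed.

Lemma Kprime_Hgrp g : Kprime g -> Hgrp g.
Proof. by exists 1%g, g; rewrite mul1g; split=> //; apply: center1. Qed.

Lemma center_Hgrp g : centerG F g -> Hgrp g.
Proof. by exists g, 1%g; rewrite mulg1; split=> //; apply: Kprime1. Qed.

Lemma HgrpM g h : Hgrp g -> Hgrp h -> Hgrp (g * h)%g.
Proof.
move=> [z [k [cz kk ->]]] [y [l [cy kl ->]]]; exists (z * y)%g, (k * l)%g.
split; [exact: centerM|exact: KprimeM|].
by rewrite !mulgA -(mulgA z y k) (cy k) !mulgA.
Qed.

Lemma HgrpV g : Hgrp g -> Hgrp (g^-1)%g.
Proof.
move=> [z [k [cz kk ->]]]; exists (z^-1)%g, (k^-1)%g.
split; [exact: centerV|exact: KprimeV|].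
by rewrite invgM (centerV cz).
Qed.

End ProUnipotent.

(** * The characters *)

Section ResidueField.
Variable F : nonarchLocalFieldType.

Lemma residue_representatives (q : nat) : residue_field F #= `I_q ->
  exists r : 'I_q -> F, [/\ forall i, integers F (r i),
    forall x, integers F x -> exists i, maxideal F (x - r i) &
    forall i j, maxideal F (r i - r j) -> i = j].
Proof.
rewrite card_eq_sym => /card_set_bijP[f [fI finj fsurj]].
have fr (i : 'I_q) : exists2 x, integers F x &
    f i = [set y | valuation_ideal (@valuation F) 1 (y - x)].
  by have [x ox fx] := fI i (ltn_ord i); exists x.
pose r i := projT1 (cid2 (fr i)).
have ro (i : 'I_q) : integers F (r i) by rewrite /r; case: cid2.
have fE (i : 'I_q) : f i = [set y | maxideal F (y - r i)] by rewrite /r;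
  case: cid2.
exists r; split=> // [x ox|i j rij].
  have : residue_field F [set y | maxideal F (y - x)] by exists x.
  move=> /fsurj[i iq fi]; exists (Ordinal iq).
  have : f (Ordinal iq) x by rewrite fi /= subrr; apply: pideal0.
  by rewrite fE.
apply: val_inj; apply: finj; rewrite ?inE //=; rewrite !fE.
apply/seteqP; split=> y /= yr.
  by rewrite -(subrKA (r i)); apply: pidealD.
rewrite -(subrKA (r j)); apply: pidealD => //.
by rewrite -opprB; apply: pidealN.
Qed.

(** Pigeonhole: two of the q + 1 integers 0, ..., q share a residue class, and n is their
    difference. *)
Lemma residue_char (q : nat) : residue_field F #= `I_q ->
  exists2 n, (0 < n)%N & maxideal F (n%:R : F).
Proof.
move=> /residue_representatives[r [ro rx rinj]].
have on (n : nat) : integers F n%:R.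
  elim: n => [|n IHn]; first exact: pideal0.
  by rewrite -addn1 natrD; apply: pidealD => //; apply: integers1.
have /choice[c cP] : forall n : nat, exists i, maxideal F (n%:R - r i).
  by move=> n; have [i ri] := rx n%:R (on n); exists i.
have /injectivePn[i [j ij cij]] : ~~ injectiveb (fun i : 'I_q.+1 => c i).
  by apply/injectiveP => /leq_card; rewrite !card_ord ltnn.
have {}cij : c i = c j by []; have pij : maxideal F (i%:R - j%:R).
  rewrite -(subrKA (r (c i))); apply: pidealD; first exact: cP.
  by rewrite cij -opprB; apply: pidealN; apply: cP.
have [lij|lji|eij] := ltngtP i j; last by rewrite (val_inj eij) eqxx in ij.
- exists (j - i)%N; first by rewrite subn_gt0.
  by rewrite natrB ?(ltnW lij) // -opprB; apply: pidealN.
- by exists (i - j)%N; rewrite ?subn_gt0 // natrB // ltnW.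
Qed.

End ResidueField.

Section Character.
Variables (R : realType) (F : nonarchLocalFieldType).
Variables (varpi : F) (psi : F -> R[i]) (t : F).
Hypotheses (hvarpi : uniformizer varpi) (hpsi : additive_character psi)
  (hpsi_o : forall x, integers F x -> psi x = 1)
  (hpsi_p : exists2 x, pideal F (- 1) x & psi x != 1)
  (ht : integer_units F t).
Implicit Types (g h k z : GSp4 F).
Local Open Scope complex_scope.

Let varpi0 : varpi != 0. Proof. by case: hvarpi. Qed.
Let t0 : t != 0. Proof. exact: unit_neq0 ht. Qed.

Lemma psi0D x y : psi0 psi varpi (x + y) = psi0 psi varpi x * psi0 psi varpi y.
Proof. by rewrite /psi0 mulrDr; case: hpsi => _ ->. Qed.

Lemma psi0_maxideal x : maxideal F x -> psi0 psi varpi x = 1.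
Proof.
case: hvarpi => _ vw px; apply: hpsi_o; rewrite /integers.
rewrite -[0](addNr 1); apply: pidealM => //; right.
by rewrite valuationV ?vw.
Qed.

Lemma psi0_cong x y : maxideal F (x - y) -> psi0 psi varpi x = psi0 psi varpi y.
Proof. by move=> /psi0_maxideal e; rewrite -(subrK y x) psi0D e mul1r. Qed.

Lemma psi0_nontrivial : exists2 u, integers F u & psi0 psi varpi u != 1.
Proof.
have [x px x1] := hpsi_p; exists (varpi * x); last by rewrite /psi0 mulKf.
rewrite /integers -[0](subrr 1); apply: pidealM => //; right.
by case: hvarpi => _ ->.
Qed.

(** With n > 0 in p, the n-th power of psi0(x) is psi0(n x) = 1, hence psi0(x) has absolute value
    1. *)
Lemma psi0_norm (q : nat) x : residue_field F #= `I_q -> integers F x ->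
  psi0 psi varpi x * (psi0 psi varpi x)^*%R = 1.
Proof.
move=> hq ox; have [n n0 pn] := residue_char hq.
have e m : psi0 psi varpi (x *+ m) = psi0 psi varpi x ^+ m.
  elim: m => [|m IHm]; last by rewrite mulrSr psi0D IHm exprSr.
  by rewrite mulr0n expr0 psi0_maxideal //; apply: pideal0.
have {e} : psi0 psi varpi x ^+ n = 1.
  by rewrite -e -mulr_natr; apply/psi0_maxideal/maxidealMl.
move=> /(congr1 Num.norm); rewrite normrX normr1 => /eqP.
by rewrite pexpr_eq1 // -normCK => /eqP ->; rewrite expr1n.
Qed.

Definition chi_arg (k : 'M[F]_4) : F := k 0 1 + k 1 2 + t * varpi^-1 * k 3 0.

Lemma chi_arg_integers k : Kprime k -> integers F (chi_arg k).
Proof.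
move=> kk; apply: pidealD; first by apply: pidealD; apply: Kprime_integers.
rewrite -mulrA; apply: integersM; first exact: unit_integers.
rewrite /integers -[0](addNr 1); apply: pidealM.
  by right; rewrite valuationV //; case: hvarpi => _ ->.
exact: Kprime_low.
Qed.

Lemma chi_arg_small (X : 'M[F]_4) : maxideal F (X 0 1) -> maxideal F (X 1 2) ->
  pideal F 2 (X 3 0) -> maxideal F (chi_arg X).
Proof.
move=> h1 h2 h3; apply: pidealD; first exact: pidealD.
rewrite -mulrA; apply: maxidealMl; first exact: unit_integers.
rewrite /maxideal -[1]/(-1 + 2%:Z); apply: pidealM => //.
by right; rewrite valuationV //; case: hvarpi => _ ->.
Qed.

(** Writing k = 1 + A and l = 1 + B, the defect is the linear form [chi_arg] at AB. The entries of
    AB at (0,1) and (1,2) lie in p, the one at (3,0) in p^2, and there the form takes values in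
    p. *)
Lemma chi_argM k l : Kprime k -> Kprime l ->
  maxideal F (chi_arg (k * l)%g - (chi_arg k + chi_arg l)).
Proof.
move=> /KprimeP kk /KprimeP kl.
pose X : 'M[F]_4 := \matrix_(i, j) \sum_m
  (k i m - (i == m)%:R) * (l m j - (m == j)%:R).
have -> : chi_arg (k * l)%g - (chi_arg k + chi_arg l) = chi_arg X.
  have e i j : (k * l)%g i j = (i == j)%:R + (k i j - (i == j)%:R) +
      (l i j - (i == j)%:R) + X i j.
    rewrite [X in _ = _ + X]mxE -[LHS](subrK (i == j)%:R) gsp4_mul_sub1; ring.
  by rewrite /chi_arg !e /=; ring.
have XE i j n : (forall m, n <= wt i m + wt m j) -> pideal F n (X i j).
  move=> nij; rewrite mxE; apply: pideal_sum => m _.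
  by apply: pideal_le (nij m) _; apply: pidealM.
by apply: chi_arg_small; apply: XE; apply: I4P.
Qed.

(** A scalar carrying one element of K' to another lies in 1 + p, by comparison of diagonal entries.
    This is what makes chi well defined on ZK'. *)
Lemma chi_arg_scalar z k : centerG F z -> Kprime k -> Kprime (z * k)%g ->
  maxideal F (chi_arg (z * k)%g - chi_arg k).
Proof.
move=> /centerGP[c c0 zE] kk kzk.
have e := scalar_mulE k zE.
have pc : maxideal F (c - 1).
  have k00 := Kprime_diag 0 kk; have := Kprime_diag 0 kzk; rewrite e => ck00.
  have u00 := one_units_unit k00.
  rewrite -(mulfK (unit_neq0 u00) c); apply: one_unitsM => //.
  exact: one_unitsV.
rewrite (_ : _ - _ = (c - 1) * chi_arg k); last by rewrite /chi_arg !e; ring.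
by apply: maxidealMr => //; apply: chi_arg_integers.
Qed.

Notation chi := (chi psi varpi t).

(** [chi] evaluates at a decomposition chosen by [xget], possibly different from (z, k); the two
    K'-parts differ by a central factor. *)
Lemma chiE z k : centerG F z -> Kprime k -> chi (z * k)%g =
  psi0 psi varpi (chi_arg k).
Proof.
move=> cz kk; rewrite /Defs.chi /=; case: xgetP => [zk _ [/= cy kl e]|];
  last first.
  by move=> /(_ (z, k))[]; split.
apply: psi0_cong.
have {e} e : zk.2 = (zk.1^-1 * z * k)%g by rewrite -mulgA e mulKg.
rewrite [in zk.2 0 1]e [in zk.2 1 2]e [in zk.2 3 0]e -/(chi_arg _);
  apply: chi_arg_scalar => //.
  by apply: centerM => //; apply: centerV.
by rewrite -e.
Qed.

Lemma chi_Kprime k : Kprime k -> chi k = psi0 psi varpi (chi_arg k).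
Proof. by move=> kk; rewrite -[k in LHS]mul1g chiE //; apply: center1. Qed.

Lemma chi_center z : centerG F z -> chi z = 1.
Proof.
move=> cz; rewrite -[z]mulg1 chiE //; last exact: Kprime1.
by apply: psi0_maxideal; rewrite /chi_arg !mxE /= mulr0 !addr0; apply: pideal0.
Qed.

Lemma chiM g h : Hgrp g -> Hgrp h -> chi (g * h)%g = chi g * chi h.
Proof.
move=> [z [k [cz kk ->]]] [y [l [cy kl ->]]].
rewrite -mulgA (mulgA k y) -(cy k) !mulgA -(mulgA (z * y)%g k l).
have kkl := KprimeM kk kl; have czy := centerM cz cy; rewrite !chiE //.
by rewrite -psi0D; apply: psi0_cong; apply: chi_argM.
Qed.

Lemma chi_norm (q : nat) g : residue_field F #= `I_q -> Hgrp g ->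
  chi g * (chi g)^*%R = 1.
Proof.
move=> hq [z [k [cz kk ->]]]; rewrite chiE //.
by apply: (psi0_norm hq); apply: chi_arg_integers.
Qed.

(** * Conjugation by [gchi] *)

Notation gchi := (gchi varpi t).
Let c : F := varpi / t.
Let c0 : c != 0. Proof. by rewrite mulf_neq0 ?invr_eq0. Qed.
Let vc : valuation c = 1.
Proof.
case: hvarpi => _ vw; case: ht => _ vt.
by rewrite valuationM ?invr_eq0 // valuationV // vw vt.
Qed.

Lemma gchiE : gchi = gchi_mx varpi t :> 'M[F]_4.
Proof. by rewrite /Defs.gchi val_insubd gchi_mxP. Qed.

Lemma gchi_sqr : centerG F (gchi * gchi)%g.
Proof.
apply/centerGP; exists (- c); first by rewrite oppr_eq0.
move=> i j; rewrite gsp4_mulE sum4 gchiE !mxE -/c.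
by elim/I4P: i; elim/I4P: j => /=; ring.
Qed.

Lemma simil_gchi : simil gchi = - c.
Proof.
have := gsp4_col gchi 0 3; rewrite !gchiE !mxE /= mulr1 => <-.
by rewrite -/c; ring.
Qed.

(** Conjugation by [gchi] permutes the affine simple root positions: (1,2) is exchanged with (3,0),
    and (0,1) with (2,3). *)
Definition gchi_conj_mx (k : 'M[F]_4) : 'M[F]_4 :=
  mx4 [:: [:: k 2 2;       - k 2 3;     - (c^-1 * k 2 0); c^-1 * k 2 1];
          [:: - k 3 2;     k 3 3;       c^-1 * k 3 0;   - (c^-1 * k 3 1)];
          [:: - (c * k 0 2); c * k 0 3;     k 0 0;         - k 0 1];
          [:: c * k 1 2;     - (c * k 1 3); - k 1 0;       k 1 1]].

Lemma gchi_conjE k : (gchi * k * gchi^-1)%g = gchi_conj_mx k :> 'M[F]_4.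
Proof.
have h : (gchi * k)%g = gchi_conj_mx k *m gchi :> 'M[F]_4.
  apply/matrixP => i j; rewrite !mxE !sum4 gchiE !mxE -/c.
  by elim/I4P: i; elim/I4P: j => /=; field.
have gV : gchi *m (gchi^-1)%g = 1%:M :> 'M[F]_4.
  exact: (congr1 (@gsp4_mx F) (mulgV gchi)).
transitivity ((gchi * k)%g *m (gchi^-1)%g : 'M[F]_4); first by [].
by rewrite h -mulmxA gV mulmx1.
Qed.

Lemma Kprime_gchi_conj k : Kprime k -> Kprime (gchi * k * gchi^-1)%g.
Proof.
move=> kk; apply/KprimeP => i j; rewrite gchi_conjE !mxE.
have cp n x : pideal F n x -> pideal F (1 + n) (c * x).
  by apply: pidealM; right; rewrite vc.
have cVp n x : pideal F n x -> pideal F (-1 + n) (c^-1 * x).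
  by apply: pidealM; right; rewrite valuationV // vc.
have kd i' := Kprime_diag i' kk.
have ko i' j' := @Kprime_off _ _ i' j' kk.
elim/I4P: i; elim/I4P: j => //=; rewrite ?subr0 //;
  do ?apply: pidealN; rewrite /wt /=.
all: by [apply: kd | apply: ko | apply: (cVp 1); apply: ko | apply: (cp 0);
  apply: ko].
Qed.

Lemma chi_arg_gchi_conj k : Kprime k ->
  maxideal F (chi_arg (gchi * k * gchi^-1)%g - chi_arg k).
Proof.
move=> kk; rewrite gchi_conjE /chi_arg !mxE /=.
rewrite (_ : _ - _ = - (k 0 1 + k 2 3)); last first.
  by rewrite /c; field; rewrite varpi0 t0.
(* The long root terms agree exactly. For the short one, orthogonality of columns 1 and 3 reads k01
   + k23 = 0 modulo p. *)
apply: pidealN; have := gsp4_col k 1 3; rewrite !mxE /= mulr0 => e.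
have ok := Kprime_integers _ _ kk; have lk := Kprime_low kk.
rewrite (_ : _ + _ = - (k 0 1 * (k 3 3 - 1) + (k 1 1 - 1) * k 2 3 -
   k 2 1 * k 1 3 - k 3 1 * k 0 3)).
  apply: pidealN; apply: pidealB; last by apply: maxidealMr => //; apply: lk.
  apply: pidealB; last by apply: maxidealMr => //; apply: lk.
  apply: pidealD; first by apply: maxidealMl => //; apply: Kprime_diag.
  by apply: maxidealMr => //; apply: Kprime_diag.
rewrite -[LHS]addr0 -[X in _ + X]oppr0 -e; ring.
Qed.

Lemma Hgrp_gchi_conj g : Hgrp g -> Hgrp (gchi * g * gchi^-1)%g.
Proof.
move=> [z [k [cz kk ->]]]; exists z, (gchi * k * gchi^-1)%g.
split=> //; first exact: Kprime_gchi_conj.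
by rewrite !mulgA (cz gchi).
Qed.

Lemma chi_gchi_conj g : Hgrp g -> chi (gchi * g * gchi^-1)%g = chi g.
Proof.
move=> [z [k [cz kk ->]]]; rewrite mulgA -(cz gchi) -!mulgA.
rewrite !chiE //; first by apply/psi0_cong; rewrite mulgA;
  apply: chi_arg_gchi_conj.
by rewrite mulgA; apply: Kprime_gchi_conj.
Qed.

(** The square of [gchi] is central, so conjugation by it is an involution. *)
Lemma gchi_conjV g : (gchi^-1 * g * gchi)%g = (gchi * g * gchi^-1)%g.
Proof.
have c2 := centerV gchi_sqr.
have -> : gchi^-1%g = (gchi * (gchi * gchi)^-1)%g.
  by rewrite invgM mulVKg.
by rewrite -!mulgA (c2 (g * gchi)%g) -!mulgA.
Qed.

(** Multipliers of elements of H have even valuation, that of [gchi] has valuation 1. *)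
Lemma gchi_notin : ~ Hgrp gchi.
Proof.
move=> [z [k [cz kk e]]]; have := congr1 (@simil F) e.
rewrite similM simil_gchi; move/centerGP: cz => [d d0 zE].
rewrite (simil_scalar zE).
have [k0 vk] := one_units_unit (simil_Kprime kk).
move=> /(congr1 (@valuation F)).
rewrite valuationN // vc expr2 !valuationM ?mulf_neq0 // vk; lia.
Qed.

Lemma Hprime_Hgrp g : Hgrp g -> Hprime varpi t g.
Proof. by left. Qed.

Lemma HprimeP g : Hprime varpi t g <-> Hgrp g \/ Hgrp (gchi^-1 * g)%g.
Proof.
split=> [[|[h hh <-]]|[|hg]]; first by left.
- by right; rewrite mulKg.
- by left.
- by right; exists (gchi^-1 * g)%g => //; rewrite mulVKg.
Qed.

Lemma Hprime_excl g : Hgrp g -> ~ Hgrp (gchi * g)%g.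
Proof.
by move=> hg hg'; apply: gchi_notin; rewrite -(mulgK g gchi); apply/HgrpM/HgrpV.
Qed.

(** * The group H' and the characters chi^+ and chi^- *)

Variable s : bool.
Notation chis := (chi_pm psi varpi t s).

Lemma chi_pmH g : Hgrp g -> chis g = chi g.
Proof. by move=> hg; rewrite /chi_pm; case: asboolP. Qed.

Lemma chi_pm_gchi g : Hgrp g -> chis (gchi * g)%g = (-1) ^+ s * chi g.
Proof.
move=> hg; rewrite /chi_pm; case: asboolP => [hg'|_]; last by rewrite mulKg.
by case: (Hprime_excl hg hg').
Qed.

Lemma gchi_swap g h : (g * (gchi * h))%g = (gchi * (gchi * g * gchi^-1 * h))%g.
Proof. by rewrite -gchi_conjV !mulgA mulgV mul1g. Qed.

Lemma HprimeM g h :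
  Hprime varpi t g -> Hprime varpi t h -> Hprime varpi t (g * h)%g.
Proof.
move=> [hg|[g' hg <-]] [hh|[h' hh <-]].
- by left; apply: HgrpM.
- rewrite gchi_swap; right; eexists => //; apply: HgrpM => //.
  exact: Hgrp_gchi_conj.
- by right; exists (g' * h)%g; rewrite ?mulgA //; apply: HgrpM.
- left; rewrite -mulgA gchi_swap mulgA; apply: HgrpM.
    exact/center_Hgrp/gchi_sqr.
  by apply: HgrpM => //; apply: Hgrp_gchi_conj.
Qed.

Lemma HprimeV g : Hprime varpi t g -> Hprime varpi t (g^-1)%g.
Proof.
move=> [hg|[g' hg <-]]; first by left; apply: HgrpV.
right; exists ((gchi * gchi)^-1 * (gchi * g'^-1 * gchi^-1))%g.
  apply: HgrpM; first exact/center_Hgrp/centerV/gchi_sqr.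
  exact/Hgrp_gchi_conj/HgrpV.
by rewrite !invgM !mulgA mulgV mul1g mulVg mul1g.
Qed.

Lemma chi_pm_norm (q : nat) g : residue_field F #= `I_q ->
  Hprime varpi t g -> chis g * (chis g)^*%R = 1.
Proof.
move=> hq [hg|[g' hg <-]]; first by rewrite chi_pmH ?(chi_norm hq).
have n1 := chi_norm hq hg; rewrite chi_pm_gchi //; case: s => /=.
  by rewrite expr1 mulN1r rmorphN mulrNN.
by rewrite expr0 mul1r.
Qed.

End Character.

(** * Elimination by the Iwahori subgroup *)

Section Elimination.
Variable F : nonarchLocalFieldType.
Implicit Types (g h k w : GSp4 F) (i j r c : 'I_4).

Lemma rev_ord_neq i : rev_ord i != i.
Proof. by elim/I4P: i. Qed.

Lemma epsM i : eps i * eps i = 1 :> F.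
Proof. by rewrite /eps; case: ifP => _; rewrite ?mulr1 ?mulrNN ?mulr1. Qed.

Lemma eps_integers i : integers F (eps i).
Proof.
rewrite /eps; case: ifP => _; first exact: integers1.
exact/pidealN/integers1.
Qed.

Lemma unip_Kprime r (v : 'I_4 -> F) :
  (forall i, i != r -> pideal F (wt i r) (v i)) -> Kprime (unip r v).
Proof.
move=> hv; apply/KprimeP => i j; rewrite !mxE.
have [->|jr] := eqVneq j r.
  have [->|ir] := eqVneq i r; first by rewrite subrr; apply: pideal0.
  by rewrite subr0; apply: hv.
have [->|ir] := eqVneq i (rev_ord r); last by rewrite subrr; apply: pideal0.
have [->|jr'] := eqVneq j (rev_ord r); first by rewrite subrr; apply: pideal0.
rewrite subr0 -(wt_rev j) rev_ordK -[wt _ _]add0r.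
apply: pidealM; last first.
  by apply: hv; apply: contra jr' => /eqP <-; rewrite rev_ordK.
by apply: integersM; apply: eps_integers.
Qed.

Lemma unipE r (v : 'I_4 -> F) i j : unip r v i j =
  if j == r then (if i == r then 1 else v i)
  else if i == rev_ord r then
    (if j == rev_ord r then 1 else eps j * eps r * v (rev_ord j))
  else (i == j)%:R.
Proof. by rewrite mxE. Qed.

Lemma gsp4_mulKE g h i j : g i j = \sum_l h i l * (h^-1 * g)%g l j.
Proof. by rewrite -gsp4_mulE mulVKg. Qed.

Lemma gsp4_mulEK g h i j : g i j = \sum_l (g * h^-1)%g i l * h l j.
Proof. by rewrite -gsp4_mulE mulgVK. Qed.

Lemma sum_delta (f : 'I_4 -> F) i : \sum_l (l == i)%:R * f l = f i.
Proof.
rewrite (bigD1 i) //= eqxx mul1r big1 ?addr0 // => l /negPf ->.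
by rewrite mul0r.
Qed.

(** The multiplier on the left is the inverse of the unipotent element sending the r-th basis vector
    to column c divided by the pivot. If that column lives in rows r and [rev_ord r], the element
    only adds multiples of row r to row [rev_ord r]; columns vanishing in row r are then untouched,
    which protects entries cleared earlier. *)
Lemma clear_col g r c : g r c != 0 ->
  (forall i, i != r -> pideal F (wt i r) (g i c / g r c)) ->
  exists k, [/\ Kprime k, forall i, i != r -> (k * g)%g i c = 0,
    forall j, (k * g)%g r j = g r j &
    (forall i, i != r -> i != rev_ord r -> g i c = 0) ->
    forall i j, g r j = 0 -> (k * g)%g i j = g i j].
Proof.
move=> g0 hg; pose v i := g i c / g r c; pose n := unip r v.
exists (n^-1)%g.
have row_r j : (n^-1 * g)%g r j = g r j.
  rewrite (gsp4_mulKE g n) -[LHS](sum_delta (fun l => (n^-1 * g)%g l j) r).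
  apply: eq_bigr => l _; congr (_ * _); rewrite unipE eqxx.
  by case: eqVneq => // lr; rewrite eq_sym (negPf (rev_ord_neq r)).
split=> //.
- by apply: KprimeV; apply: unip_Kprime.
- move=> i ir; rewrite gsp4_mulE.
  have e l : g l c = n l r * g r c.
    rewrite unipE eqxx; case: eqVneq => [->|_]; first by rewrite mul1r.
    by rewrite /v divfK.
  under eq_bigr => l _ do rewrite e mulrA.
  by rewrite -mulr_suml -gsp4_mulE mulVg gsp4_oneE (negPf ir) mul0r.
- move=> hv i j grj; rewrite [RHS](gsp4_mulKE g n).
  rewrite -[LHS](sum_delta (fun l => (n^-1 * g)%g l j) i).
  apply: eq_bigr => l _; have [lr|lr] := eqVneq l r.
    by rewrite lr row_r grj !mulr0.
  congr (_ * _); rewrite unipE (negPf lr).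
  have [->|ir] := eqVneq i (rev_ord r); last by rewrite eq_sym.
  case: eqVneq => // lr'; rewrite /v hv ?mul0r ?mulr0 //.
    by apply: contra lr' => /eqP <-; rewrite rev_ordK.
  by rewrite (inj_eq rev_ord_inj).
Qed.

Lemma clear_row g r c : g r c != 0 ->
  (forall j, j != c -> pideal F (wt c j) (g r j / g r c)) ->
  exists k, [/\ Kprime k, forall j, j != c -> (g * k)%g r j = 0,
    forall i, (g * k)%g i c = g i c &
    forall i j, j != c -> j != rev_ord c -> g r j = 0 ->
      (g * k)%g i j = g i j].
Proof.
move=> g0 hg; pose y j := g r j / g r c.
(* The signs undo those of [unip], so that row c of n is row r of g divided by the pivot. *)
pose v i := eps (rev_ord i) * eps (rev_ord c) * y (rev_ord i).
pose n := unip (rev_ord c) v; exists (n^-1)%g.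
have row_c j : n c j = y j.
  rewrite unipE rev_ordK eqxx (eq_sym c) (negPf (rev_ord_neq c)).
  have [->|jc] := eqVneq j (rev_ord c); first by rewrite /v epsM mul1r.
  have [->|jc'] := eqVneq j c; first by rewrite /y divff.
  rewrite /v rev_ordK mulrA (mulrACA (eps j)) -!mulrA.
  by rewrite mulrA epsM mul1r mulrA epsM mul1r.
split.
- apply: KprimeV; apply: unip_Kprime => i ic; rewrite /v -[wt _ _]add0r.
  apply: pidealM; first by apply: integersM; apply: eps_integers.
  rewrite -[i in wt i]rev_ordK wt_rev; apply: hg.
  by apply: contra ic => /eqP <-; rewrite rev_ordK.
- move=> j jc; rewrite gsp4_mulE.
  have e l : g r l = g r c * n c l by rewrite row_c /y mulrCA divff ?mulr1.
  under eq_bigr => l _ do rewrite e -mulrA.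
  by rewrite -mulr_sumr -gsp4_mulE mulgV gsp4_oneE eq_sym (negPf jc) mulr0.
- move=> i; rewrite [RHS](gsp4_mulEK g n).
  rewrite -[LHS](sum_delta (fun l => (g * n^-1)%g i l) c).
  apply: eq_bigr => l _; rewrite mulrC; congr (_ * _).
  rewrite unipE eq_sym rev_ordK (eq_sym c) (negPf (rev_ord_neq c)) eqxx.
  by rewrite (eq_sym c); case: eqVneq.
- move=> i j jc jc' grj; rewrite [RHS](gsp4_mulEK g n).
  rewrite -[LHS](sum_delta (fun l => (g * n^-1)%g i l) j).
  apply: eq_bigr => l _; rewrite mulrC; congr (_ * _).
  have [lc|lc] := eqVneq l c.
    by rewrite lc row_c /y grj mul0r eq_sym (negPf jc).
  by rewrite unipE (negPf jc') rev_ordK (negPf lc).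
Qed.

Lemma Jmx_neq i j : j != rev_ord i -> Jmx F i j = 0.
Proof. by rewrite mxE; elim/I4P: i; elim/I4P: j. Qed.

Lemma Jmx_rev_neq0 i : Jmx F i (rev_ord i) != 0.
Proof. by rewrite mxE; elim/I4P: i; rewrite /= ?oppr_eq0 oner_neq0. Qed.

Lemma Jmx_neq0 i j : Jmx F i j != 0 -> j = rev_ord i.
Proof. by have [->//|/Jmx_neq ->] := eqVneq j (rev_ord i); rewrite eqxx. Qed.

Lemma gsp4_colJ g i j :
  \sum_k \sum_l g k i * Jmx F k l * g l j = simil g * Jmx F i j.
Proof.
by rewrite !sum4 -(gsp4_col g i j) !mxE /=; ring.
Qed.

Lemma gsp4_rowJ g i j :
  \sum_k \sum_l g i k * Jmx F k l * g j l = simil g * Jmx F i j.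
Proof.
by rewrite !sum4 -(gsp4_row g i j) !mxE /=; ring.
Qed.

(** When column c has a single entry, its J-pairing with column j is that entry times
    [g (rev_ord r) j], up to sign. Clearing a column therefore clears the opposite row. *)
Lemma col_dual g r c : (forall i, i != r -> g i c = 0) ->
  forall j, j != rev_ord c -> g (rev_ord r) j = 0.
Proof.
move=> hc j jc; have := gsp4_colJ g c j; rewrite (Jmx_neq jc) mulr0.
rewrite (bigD1 r) //= [X in _ + X]big1 => [|i ir]; last first.
  by rewrite big1 // => l _; rewrite hc // !mul0r.
rewrite addr0 (bigD1 (rev_ord r)) //= big1 => [|l lr]; last first.
  by rewrite Jmx_neq // mulr0 mul0r.
rewrite addr0 => /eqP; rewrite !mulf_eq0 (negPf (Jmx_rev_neq0 r)) orbF.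
(* A vanishing pivot would make column c zero, against its nonzero pairing with column
   [rev_ord c]. *)
case/orP => [/eqP g0|/eqP //]; have := gsp4_colJ g c (rev_ord c).
rewrite big1 => [/esym/eqP|i _].
  by rewrite mulf_eq0 (negPf (simil_neq0 g)) (negPf (Jmx_rev_neq0 c)).
rewrite big1 // => l _; have [->|ir] := eqVneq i r; first by rewrite g0 !mul0r.
by rewrite hc // !mul0r.
Qed.

Lemma row_dual g r c : (forall j, j != c -> g r j = 0) ->
  forall i, i != rev_ord r -> g i (rev_ord c) = 0.
Proof.
move=> hr i ir; have := gsp4_rowJ g r i; rewrite (Jmx_neq ir) mulr0.
rewrite (bigD1 c) //= [X in _ + X]big1 => [|j jc]; last first.
  by rewrite big1 // => l _; rewrite hr // !mul0r.
rewrite addr0 (bigD1 (rev_ord c)) //= big1 => [|l lr]; last first.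
  by rewrite Jmx_neq // mulr0 mul0r.
rewrite addr0 => /eqP; rewrite !mulf_eq0 (negPf (Jmx_rev_neq0 c)) orbF.
case/orP => [/eqP g0|/eqP //]; have := gsp4_rowJ g r (rev_ord r).
rewrite big1 => [/esym/eqP|j _].
  by rewrite mulf_eq0 (negPf (simil_neq0 g)) (negPf (Jmx_rev_neq0 r)).
rewrite big1 // => l _; have [->|jc] := eqVneq j c; first by rewrite g0 !mul0r.
by rewrite hr // !mul0r.
Qed.

Lemma gsp4_col_neq0 g j : exists i, g i j != 0.
Proof.
apply: contrapT => h; have g0 i : g i j = 0.
  by apply/eqP/negPn/negP => gi; apply: h; exists i.
have := gsp4_colJ g j (rev_ord j); rewrite big1 => [/esym/eqP|i _].
  by rewrite mulf_eq0 (negPf (simil_neq0 g)) (negPf (Jmx_rev_neq0 j)).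
by rewrite big1 // => l _; rewrite g0 !mul0r.
Qed.

(* A pivot: an entry of minimal valuation, lowest and then leftmost among
   those. *)
Lemma pivot g (P Q : pred 'I_4) i0 j0 : P i0 -> Q j0 -> g i0 j0 != 0 ->
  exists r c, [/\ P r, Q c, g r c != 0,
    forall i, P i -> i != r -> pideal F (wt i r) (g i c / g r c) &
    forall j, Q j -> j != c -> pideal F (wt c j) (g r j / g r c)].
Proof.
move=> Pi0 Qj0 g0.
(* A lexicographic order in one integer: the index terms range over 0, ..., 15, below the weight 16
   of the valuation. The tie-breaking makes the valuation inequality strict exactly where [wt] is
   1. *)
pose key (ij : 'I_4 * 'I_4) : int :=
  16 * valuation (g ij.1 ij.2) + 4 * (3 - (ij.1 : nat)%:Z) + (ij.2 : nat)%:Z.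
pose S (ij : 'I_4 * 'I_4) := [&& P ij.1, Q ij.2 & g ij.1 ij.2 != 0].
have S0 : S (i0, j0) by rewrite /S /= Pi0 Qj0.
case: (arg_minP key S0) => -[r c] /and3P[/= Pr Qc grc] hmin.
exists r, c; split=> // [i Pi ir|j Qj jc].
  have [->|gi] := eqVneq (g i c) 0; first by rewrite mul0r; apply: pideal0.
  right; rewrite valuationM ?invr_eq0 // valuationV //.
  have := hmin (i, c); rewrite /S /key /= Pi Qc gi => /(_ isT).
  rewrite /wt; case: ltnP; have := ltn_ord i; have := ltn_ord r; move: ir.
  rewrite -val_eqE /=; lia.
  rewrite -val_eqE /=; lia.
have [->|gj] := eqVneq (g r j) 0; first by rewrite mul0r; apply: pideal0.
right; rewrite valuationM ?invr_eq0 // valuationV //.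
have := hmin (r, j); rewrite /S /key /= Pr Qj gj => /(_ isT).
rewrite /wt; case: ltnP; have := ltn_ord j; have := ltn_ord c; move: jc.
rewrite -val_eqE /=; lia.
rewrite -val_eqE /=; lia.
Qed.

Definition monomial g := forall j, exists i, forall l, l != i -> g l j = 0.

Lemma clear_cross g : exists k1 k2 r c, [/\ Kprime k1, Kprime k2,
  forall i, i != r -> (k1 * g * k2)%g i c = 0 &
  forall j, j != c -> (k1 * g * k2)%g r j = 0].
Proof.
have [i0 g0] := gsp4_col_neq0 g 0.
have [r [c [_ _ grc hc hr]]] := @pivot g xpredT xpredT i0 0 isT isT g0.
have [|k1 [kk1 c1 r1 _]] := @clear_col g r c grc; first by move=> i; apply: hc.
have [||k2 [kk2 r2 c2 _]] := @clear_row (k1 * g)%g r c.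
- by rewrite r1.
- by move=> j jc; rewrite !r1; apply: hr.
by exists k1, k2, r, c; split=> // i ir; rewrite c2 c1.
Qed.

Lemma off_block c : exists j, (j != c) && (j != rev_ord c).
Proof. by elim/I4P: c; [exists 1|exists 0|exists 0|exists 1]. Qed.

Lemma in_block c c2 j : c2 != c -> c2 != rev_ord c -> j != c2 ->
  j != rev_ord c2 -> (j == c) || (j == rev_ord c).
Proof. by elim/I4P: c; elim/I4P: c2; elim/I4P: j. Qed.

(** By duality the cross at (r, c) comes with one at the opposite position, so only a two by two
    block is left. A pivot in that block clears its row and column, and duality clears its remaining
    column. *)
Lemma clear_block g r c :
  (forall i, i != r -> g i c = 0) -> (forall j, j != c -> g r j = 0) ->
  exists k1 k2, [/\ Kprime k1, Kprime k2 & monomial (k1 * g * k2)%g].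
Proof.
move=> gc gr; have gc' := row_dual gr; have gr' := col_dual gc.
pose P := [pred i | (i != r) && (i != rev_ord r)].
pose Q := [pred j | (j != c) && (j != rev_ord c)].
have [j1 Qj1] : exists j, Q j by apply: off_block.
have [i1 g1] := gsp4_col_neq0 g j1.
have Pi1 : P i1.
  case/andP: Qj1 => jc jc'; apply/andP; split; apply: contra g1 => /eqP ->.
    by rewrite gr.
  by rewrite gr'.
have [r2 [c2 [/andP[r2r r2r'] /andP[c2c c2c'] g2 hc hr]]] := pivot Pi1 Qj1 g1.
have [||k1 [kk1 c1 r1 st1]] := @clear_col g r2 c2; first by [].
  move=> i ir; have [->|i_r] := eqVneq i r; first by rewrite gr // mul0r;
    apply: pideal0.
  have [->|i_r'] := eqVneq i (rev_ord r); first by rewrite gr' // mul0r;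
    apply: pideal0.
  by apply: hc => //; apply/andP.
have gr2c : g r2 c = 0 by apply: gc.
have gr2c' : g r2 (rev_ord c) = 0 by apply: gc'.
(* Column c2 vanishes in rows r and [rev_ord r], so the protecting clause of [clear_col] applies:
   the first cross and its dual survive. *)
have {}st1 i j : j = c \/ j = rev_ord c -> (k1 * g)%g i j = g i j.
  move=> jc; apply: st1 => [l lr lr'|]; last by case: jc => ->.
  have /orP[/eqP ->|/eqP ->] : (l == r) || (l == rev_ord r).
    exact: in_block lr lr'.
  by apply: gr.
  by apply: gr'.
have [||k2 [kk2 r2' c2' st2]] := @clear_row (k1 * g)%g r2 c2.
- by rewrite r1.
- move=> j jc; rewrite !r1; have [->|j_c] := eqVneq j c.
    by rewrite gr2c mul0r; apply: pideal0.
  have [->|j_c'] := eqVneq j (rev_ord c); first by rewrite gr2c' mul0r;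
    apply: pideal0.
  by apply: hr => //; apply/andP.
exists k1, k2; split=> // j.
have [->|jc2] := eqVneq j c2; first by exists r2 => l lr; rewrite c2' c1.
have [->|jc2'] := eqVneq j (rev_ord c2).
  by exists (rev_ord r2) => l lr; apply: (row_dual (r := r2)).
have [->|jc] := eqVneq j c.
  exists r => l lr; rewrite st2 ?r1 //; last 2 first.
  - by rewrite eq_sym.
  - by apply: contra c2c' => /eqP ->; rewrite rev_ordK.
  by rewrite st1 ?gc //; left.
have jE : j = rev_ord c.
  by have := in_block c2c c2c' jc2 jc2'; rewrite (negPf jc) => /eqP.
exists (rev_ord r) => l lr; rewrite jE st2 ?r1 //.
- by rewrite st1 ?gc' //; right.
- by rewrite eq_sym.
- by rewrite (inj_eq rev_ord_inj) eq_sym.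
Qed.

Theorem Kprime_monomial g :
  exists k1 k2, [/\ Kprime k1, Kprime k2 & monomial (k1 * g * k2)%g].
Proof.
have [k1 [k2 [r [c [kk1 kk2 gc gr]]]]] := clear_cross g.
have [l1 [l2 [ll1 ll2 m]]] := clear_block gc gr.
exists (l1 * k1)%g, (k2 * l2)%g; split; [exact: KprimeM|exact: KprimeM|].
by move: m; rewrite !mulgA.
Qed.

End Elimination.

(** * Intertwining *)

Section MonomialEntries.
Variable F : nonarchLocalFieldType.
Implicit Types (g h k w : GSp4 F) (i j m : 'I_4).

Section Monomial.
Variables (w : GSp4 F) (p : 'I_4 -> 'I_4).
Hypothesis wp : forall j l, l != p j -> w l j = 0.
Let a j := w (p j) j.

Lemma monomial_J i j : a i * Jmx F (p i) (p j) * a j = simil w * Jmx F i j.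
Proof.
rewrite -gsp4_colJ (bigD1 (p i)) //= [X in _ = _ + X]big1 => [|k ki];
  last first.
  by rewrite big1 // => l _; rewrite wp // !mul0r.
rewrite addr0 (bigD1 (p j)) //= big1 ?addr0 // => l lj.
by rewrite (wp lj) mulr0.
Qed.

Lemma monomial_neq0 j : a j != 0.
Proof.
apply/eqP => aj; have := monomial_J j (rev_ord j).
rewrite aj !mul0r => /esym/eqP.
by rewrite mulf_eq0 (negPf (simil_neq0 w)) (negPf (Jmx_rev_neq0 _ j)).
Qed.

Lemma monomial_rev j : p (rev_ord j) = rev_ord (p j).
Proof.
apply: (@Jmx_neq0 F); apply/eqP => J0; have := monomial_J j (rev_ord j).
rewrite J0 mulr0 mul0r => /esym/eqP.
by rewrite mulf_eq0 (negPf (simil_neq0 w)) (negPf (Jmx_rev_neq0 _ j)).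
Qed.

Lemma monomial_inj : injective p.
Proof.
move=> i j pij; have h := monomial_J i (rev_ord j).
have /Jmx_neq0 /rev_ord_inj -> // : Jmx F i (rev_ord j) != 0.
apply/eqP => J0; move: h; rewrite J0 mulr0 monomial_rev pij => /eqP.
by rewrite !mulf_eq0 !(negPf (monomial_neq0 _)) (negPf (Jmx_rev_neq0 _ _)).
Qed.

(** The entries of opposite columns multiply to the multiplier up to sign. The alternative is
    phrased through p so that concrete opposite indices can be supplied and the first case
    refuted. *)
Lemma monomial_val i j : p j != rev_ord (p i) \/
  valuation (a i) + valuation (a j) = valuation (simil w).
Proof.
have [e|] := eqVneq; last by left. right.
have {}e : j = rev_ord i by apply: monomial_inj; rewrite monomial_rev.
have Jv l : valuation (Jmx F l (rev_ord l)) = 0.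
  by elim/I4P: l; rewrite mxE /= ?valuationN ?oner_neq0 // valuation1.
have := congr1 (@valuation F) (monomial_J i j).
rewrite e monomial_rev !valuationM ?mulf_neq0 ?Jmx_rev_neq0 ?monomial_neq0
  ?simil_neq0 //.
by rewrite !Jv; lia.
Qed.

Lemma monomial_conj k m j : (w * k * w^-1)%g (p m) (p j) = a m * k m j / a j.
Proof.
have aj := monomial_neq0 j.
apply: (mulIf aj); rewrite divfK //.
have e : (w * k * w^-1 * w)%g (p m) j = (w * k)%g (p m) j by rewrite mulgVK.
move: e; rewrite gsp4_mulE (bigD1 (p j)) //= big1 ?addr0; last first.
  by move=> l lj; rewrite (wp lj) mulr0.
move=> ->; rewrite -[LHS]/((w * k)%g (p m) j) gsp4_mulE (bigD1 m) //=
  big1 ?addr0 //.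
move=> l lm; rewrite wp ?mul0r //; apply: contra lm => /eqP e.
by apply/eqP/monomial_inj.
Qed.

End Monomial.
End MonomialEntries.

Section Intertwining.
Variables (R : realType) (F : nonarchLocalFieldType).
Variables (varpi : F) (psi : F -> R[i]) (t : F).
Hypotheses (hvarpi : uniformizer varpi) (hpsi : additive_character psi)
  (hpsi_o : forall x, integers F x -> psi x = 1)
  (hpsi_p : exists2 x, pideal F (- 1) x & psi x != 1)
  (ht : integer_units F t).
Implicit Types (g h k y w : GSp4 F) (i j m : 'I_4).

Notation chi := (chi psi varpi t).
Notation gchi := (gchi varpi t).
Notation chi_arg := (chi_arg varpi t).

Let chiM_ := chiM hvarpi hpsi hpsi_o ht.

(** Tested on K' only: a failure still yields a witness in H', and the condition is stable under
    multiplication by K' on both sides and under [gchi^-1] on the left, as the reduction to diagonal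
    matrices requires. *)
Definition intertwines y := forall k,
  Kprime k -> Kprime (y * k * y^-1)%g -> chi (y * k * y^-1)%g = chi k.

Lemma intertwines_Kprime y k1 k2 : Kprime k1 -> Kprime k2 ->
  intertwines y -> intertwines (k1 * y * k2)%g.
Proof.
move=> kk1 kk2 hy k kk; set m := (y * (k2 * k * k2^-1) * y^-1)%g.
have -> : (k1 * y * k2 * k * (k1 * y * k2)^-1 = k1 * m * k1^-1)%g.
  by rewrite /m !invgM !mulgA.
move=> km; have kl : Kprime (k2 * k * k2^-1)%g.
  by apply: KprimeM; [exact: KprimeM|exact: KprimeV].
have {km} km : Kprime m.
  have -> : m = (k1^-1 * (k1 * m * k1^-1) * k1)%g.
    by move: m {km} => m; rewrite !mulgA mulVg mul1g mulgVK.
  by apply: KprimeM => //; apply: KprimeM => //; apply: KprimeV.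
have chi_conj a b : Kprime a -> Kprime b -> chi (a * b * a^-1)%g = chi b.
  move=> ka kb; have [ha hb] := (Kprime_Hgrp ka, Kprime_Hgrp kb).
  have [haV hab] := (HgrpV ha, HgrpM ha hb).
  rewrite !chiM_ // mulrAC -chiM_ // mulgV.
  by rewrite (chi_center hvarpi hpsi hpsi_o ht (@center1 F)) mul1r.
by rewrite chi_conj // hy // chi_conj.
Qed.

Lemma intertwines_gchi y : intertwines y -> intertwines (gchi^-1 * y)%g.
Proof.
move=> hy k kk; set m := (y * k * y^-1)%g.
have -> : (gchi^-1 * y * k * (gchi^-1 * y)^-1 = gchi^-1 * m * gchi)%g.
  by rewrite invgM invgK !mulgA.
move=> km; have km' : Kprime m.
  have := Kprime_gchi_conj hvarpi ht km; move: m {km} => m.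
  by rewrite !mulgA mulgV mul1g mulgK.
rewrite gchi_conjV // (chi_gchi_conj hvarpi hpsi hpsi_o) ?hy //.
exact: Kprime_Hgrp.
Qed.

(* Entries [(i, j)] in [p^(cwt i j)] do not contribute to [chi]; [cwt] exceeds
   [wt] exactly at the affine simple roots. *)
Definition cwt i j : int :=
  wt i j + ((nat_of_ord i, nat_of_ord j) \in
    [:: (0, 1); (2, 3); (1, 2); (3, 0)]%N : nat)%:Z.

Lemma cwt_wt i j : wt i j <= cwt i j.
Proof. by rewrite /cwt lerDl. Qed.

Lemma cwt_rev i j : cwt (rev_ord j) (rev_ord i) = cwt i j.
Proof. by elim/I4P: i; elim/I4P: j. Qed.

Lemma chi_arg_cwt k : (forall i j, i != j -> pideal F (cwt i j) (k i j)) ->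
  maxideal F (chi_arg k).
Proof.
move=> hk; apply: (chi_arg_small hvarpi ht).
- exact: (hk 0 1 isT).
- exact: (hk 1 2 isT).
- exact: (hk 3 0 isT).
Qed.

(** The inequality puts the off-diagonal entries of the conjugate of k into p^(cwt); the conjugate
    then lies in K' with chi trivial on it, and intertwining transfers this back to k. *)
Lemma monomial_psi0 w p k : (forall j l, l != p j -> w l j = 0) ->
  intertwines w -> Kprime k -> (forall j, k j j = 1) ->
  (forall m j, m != j -> k m j != 0 ->
    cwt (p m) (p j) <= valuation (w (p m) m) - valuation (w (p j) j) + wt m j)
      ->
  psi0 psi varpi (chi_arg k) = 1.
Proof.
move=> wp hw kk kd hk; pose a j := w (p j) j.
have a0 j : a j != 0 by apply: monomial_neq0.
have pinj := monomial_inj wp; have [p' pK p'K] := injF_bij pinj.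
set l := (w * k * w^-1)%g.
have off i j : i != j -> pideal F (cwt i j) (l i j).
  rewrite -(p'K i) -(p'K j); set m := p' i; set n := p' j;
    rewrite (inj_eq pinj) => mn.
  rewrite /l (monomial_conj wp) -/(a m) -/(a n).
  have [->|k0] := eqVneq (k m n) 0; first by rewrite mulr0 mul0r;
    apply: pideal0.
  apply: pideal_le (hk m n mn k0) _; rewrite -/(a m) -/(a n) addrAC.
  apply: pidealM; last by right; rewrite valuationV.
  by apply: pidealM; [right|apply: Kprime_off].
have kl : Kprime l.
  apply/KprimeP => i j; have [->|ij] := eqVneq i j; last first.
    by rewrite subr0; apply: pideal_le (cwt_wt i j) (off i j ij).
  rewrite -(p'K j) /l (monomial_conj wp) kd mulr1 divff ?subrr; last exact: a0.
  exact: pideal0.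
rewrite -(chi_Kprime hvarpi hpsi hpsi_o ht kk) -hw // -/l chi_Kprime //.
by apply: (psi0_maxideal hvarpi hpsi_o); apply: chi_arg_cwt.
Qed.

Lemma unip_simple (r i : 'I_4) (u : F) : i != r -> pideal F (wt i r) u ->
  Kprime (unip r (fun l => if l == i then u else 0)).
Proof.
by move=> ir hu; apply: unip_Kprime => l lr; case: eqP => [->//|_];
  apply: pideal0.
Qed.

(** If one inequality failed, [monomial_psi0] would make chi trivial on the whole corresponding
    affine simple root group, whereas psi0(u) is not 1 for some u in o. The + 1 in the last
    inequality is there because the affine root group starts at p. *)
Lemma monomial_simple w p : (forall j l, l != p j -> w l j = 0) ->
  intertwines w -> let v j := valuation (w (p j) j) in
  [/\ v 0 - v 1 < cwt (p 0) (p 1), v 1 - v 2 < cwt (p 1) (p 2) &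
      v 3 - v 0 + 1 < cwt (p 3) (p 0)].
Proof.
move=> wp hw v; have [u ou u1] := psi0_nontrivial hvarpi hpsi_p.
have hv := monomial_psi0 wp hw.
have vE i : valuation (w (p i) i) = v i by [].
have rv j := monomial_rev wp j.
have v03 : v 0 + v 3 = v 1 + v 2.
  have [|e03] := monomial_val wp 0 3; first by rewrite -rv rev4E eqxx.
  have [|e12] := monomial_val wp 1 2; first by rewrite -rv rev4E eqxx.
  by rewrite /v e03 e12.
have pu : maxideal F (varpi * u).
  by rewrite /maxideal -[1]addr0; apply: pidealM => //; right; case: hvarpi =>
    _ ->.
split; rewrite ltNge; apply/negP => h; move: u1; apply/negP/negPn/eqP.
- have kk := unip_simple (r := 1) (i := 0) isT ou.
  rewrite -(hv _ kk) => [|j|m j].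
  + by rewrite /chi_arg !unipE /= ?rev4E /=; congr psi0; ring.
  + by rewrite unipE; elim/I4P: j.
  rewrite unipE; elim/I4P: m; elim/I4P: j => //=; rewrite ?rev4E /=
    ?mulr0 ?eqxx // => _ _.
  + by apply: (le_trans h); rewrite !vE lerDl wt_ge0.
  (* A short root element has a second entry at (2,3). Its bound is that of (0,1), by the symmetry
     of [cwt] and v0 + v3 = v1 + v2. *)
  rewrite -(cwt_rev (p 2) (p 3)) -!rv !rev4E; apply: (le_trans h).
  by rewrite !vE; have := wt_ge0 2 3; lia.
- have kk := unip_simple (r := 2) (i := 1) isT ou.
  rewrite -(hv _ kk) => [|j|m j].
  + by rewrite /chi_arg !unipE /= ?rev4E /=; congr psi0; ring.
  + by rewrite unipE; elim/I4P: j.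
  rewrite unipE; elim/I4P: m; elim/I4P: j => //=; rewrite ?rev4E /=
    ?mulr0 ?eqxx // => _ _.
  by apply: (le_trans h); rewrite !vE lerDl wt_ge0.
(* Chosen so that the coefficient t / varpi of the (3,0) entry in chi turns it back into u. *)
pose u' := varpi / t * u.
have pu' : maxideal F u'.
  rewrite /u' mulrAC; apply: maxidealMr => //; exact/unit_integers/unitV.
have kk := unip_simple (r := 0) (i := 3) isT pu'.
rewrite -(hv _ kk) => [|j|m j].
+ rewrite /chi_arg !unipE /= ?rev4E /= /u'; congr psi0; field.
  by rewrite (unit_neq0 ht); case: hvarpi => ->.
+ by rewrite unipE; elim/I4P: j.
rewrite unipE; elim/I4P: m; elim/I4P: j => //=; rewrite ?rev4E /=
  ?mulr0 ?eqxx // => _ _.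
Qed.

(* The point is that [2 (v0 - v1) + (v1 - v2) + (v3 - v0) = 0]. *)
Lemma affine_weyl_dichotomy (x y : 'I_4) (v0 v1 v2 v3 : int) :
  y != x -> y != rev_ord x -> v0 + v3 = v1 + v2 -> v0 - v1 < cwt x y ->
  v1 - v2 < cwt y (rev_ord y) -> v3 - v0 + 1 < cwt (rev_ord x) x ->
  x = 0 /\ y = 1 \/ x = 2 /\ y = 3.
Proof.
elim/I4P: x; elim/I4P: y => //; rewrite /cwt /wt /= ?inE /=; try (by left);
  try (by right); lia.
Qed.

(** The two outcomes are the permutations underlying a diagonal matrix and [gchi]; the values at 2
    and 3 follow as p commutes with [rev_ord]. *)
Lemma monomial_perm w p : (forall j l, l != p j -> w l j = 0) ->
  intertwines w -> p 0 = 0 /\ p 1 = 1 \/ p 0 = 2 /\ p 1 = 3.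
Proof.
move=> wp hw; have [] := monomial_simple wp hw.
have rv := monomial_rev wp.
have [|e03] := monomial_val wp 0 3; first by rewrite -rv rev4E eqxx.
have [|e12] := monomial_val wp 1 2; first by rewrite -rv rev4E eqxx.
have p3 : p 3 = rev_ord (p 0) by rewrite -rv rev4E.
have p2 : p 2 = rev_ord (p 1) by rewrite -rv rev4E.
move: e03 e12; rewrite p2 p3 => e03 e12 h1 h2 h3.
apply: affine_weyl_dichotomy h1 h2 h3.
- by apply/eqP => /(monomial_inj wp).
- by rewrite -p3; apply/eqP => /(monomial_inj wp).
- by rewrite e03 e12.
Qed.

Lemma diagonal_intertwines w : (forall i j, i != j -> w i j = 0) ->
  intertwines w -> Hgrp w.
Proof.
move=> wd hw; have wp j l : l != id j -> w l j = 0 by apply: wd.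
have := monomial_val wp 0 3; have := monomial_val wp 1 2.
have [] := monomial_simple wp hw.
pose a j := w j j; have a0 j : a j != 0 by apply: (monomial_neq0 wp).
rewrite -/(a 0) -/(a 1) -/(a 2) -/(a 3) /cwt /wt /=.
move=> h1 h2 h3 [//|e12] [//|e03].
(* The strict inequalities say that v0 - v1, v1 - v2 and v3 - v0 are at most 0, and 2(v0 - v1) + (v1
   - v2) + (v3 - v0) = 0 forces equality throughout. *)
have v01 : valuation (a 0) = valuation (a 1) by lia.
have v12 : valuation (a 1) = valuation (a 2) by lia.
have v23 : valuation (a 2) = valuation (a 3) by lia.
have [u ou u1] := psi0_nontrivial hvarpi hpsi_p.
(* If d = a_i / a_j - 1 were a unit, each u in o would be x d with x in o, and invariance of psi0
   under x -> x a_i / a_j would give psi0(u) = 1. *)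
have key i j : i != j -> valuation (a i) = valuation (a j) ->
    (forall x, integers F x -> psi0 psi varpi (x * (a i / a j)) =
      psi0 psi varpi x) ->
    maxideal F (a i / a j - 1).
  move=> ij vij h; apply: contrapT => np.
  have uij : integer_units F (a i / a j).
    split; first by rewrite mulf_neq0 ?invr_eq0.
    by rewrite valuationM ?invr_eq0 // valuationV // vij subrr.
  have ud : integer_units F (a i / a j - 1).
    apply: unit_notin_maxideal => //; apply: pidealB; last exact: integers1.
    exact: unit_integers.
  move: u1; apply/negP/negPn/eqP.
  set d := a i / a j - 1 in np ud.
  have ox : integers F (u / d) by apply: integersM => //;
    apply/unit_integers/unitV.
  rewrite (_ : u = u / d * (a i / a j) - u / d); last first.
    by rewrite -[X in _ - X]mulr1 -mulrBr -/d divfK ?unit_neq0.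
  have := h _ ox; set z := _ / d; set y := z * _ => e.
  rewrite -[psi0 _ _ (y - z)]mulr1.
  have pz : psi0 psi varpi z != 0 by rewrite /psi0; case: hpsi => + _ _; apply.
  by apply: (mulIf pz); rewrite mul1r mulr1 -(psi0D varpi hpsi) subrK e.
have conj k m j : (w * k * w^-1)%g m j = a m * k m j / a j.
  exact: (monomial_conj wp).
have va m j : valuation (a m) = valuation (a j).
  by elim/I4P: m; elim/I4P: j; rewrite ?v01 ?v12 ?v23.
have kconj k : Kprime k -> (forall j, k j j = 1) -> Kprime (w * k * w^-1)%g.
  move=> kk kd; apply/KprimeP => m j; rewrite conj.
  have [->|mj] := eqVneq m j; first by rewrite kd mulr1 divff // subrr;
    apply: pideal0.
  rewrite subr0 mulrAC -[wt m j]add0r; apply: pidealM; last exact: Kprime_off.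
  by right; rewrite valuationM ?invr_eq0 // valuationV // (va m j) subrr.
have psiconj k : Kprime k -> (forall j, k j j = 1) ->
    psi0 psi varpi (chi_arg (w * k * w^-1)%g) = psi0 psi varpi (chi_arg k).
  move=> kk kd; have kl := kconj k kk kd.
  by rewrite -!(chi_Kprime hvarpi hpsi hpsi_o ht) // hw.
have u_diag r i x l : i != r -> unip r (fun m => if m == i then x else 0) l l =
  1 :> F.
  move=> ir; rewrite unipE eqxx; have [//|lr] := eqVneq l r.
  by case: eqVneq.
have a01 : maxideal F (a 0 / a 1 - 1).
  apply: key => // x ox.
  have := psiconj _ (unip_simple (r := 1) (i := 0) isT ox) (fun l =>
    @u_diag 1 0 x l isT).
  rewrite /chi_arg !conj !unipE /= !(mulr0, mul0r, addr0) => <-.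
  by congr psi0; ring.
have a12 : maxideal F (a 1 / a 2 - 1).
  apply: key => // x ox.
  have := psiconj _ (unip_simple (r := 2) (i := 1) isT ox) (fun l =>
    @u_diag 2 1 x l isT).
  rewrite /chi_arg !conj !unipE /= !(mulr0, mul0r, addr0, add0r) => <-.
  by congr psi0; ring.
have a0312 : a 0 * a 3 = a 1 * a 2.
  have := monomial_J wp 0 3; have := monomial_J wp 1 2.
  by rewrite !mxE /= !mulr1 -/(a 0) -/(a 1) -/(a 2) -/(a 3) => -> ->.
have [z cz zE] := center_scalar (a0 0).
exists z, (z^-1 * w)%g; split=> //; last by rewrite mulVKg.
have e := scalar_mulVE w (a0 0) zE.
apply/KprimeP => i j; rewrite e; have [<-|ij] := eqVneq i j; last first.
  by rewrite wd // mul0r subrr; apply: pideal0.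
rewrite /wt ltnn -/(a i); have b01 := one_unitsV a01; have b12 :=
  one_unitsV a12.
have b02 := one_unitsM b01 b12.
elim/I4P: i {e}.
- by rewrite divff // subrr; apply: pideal0.
- by move: b01; rewrite invf_div.
- move: b02; rewrite !invf_div [X in X - 1](_ : _ = a 2 / a 0) //.
  by field; rewrite !a0.
(* The last ratio is not tested by a root group: a0 a3 = a1 a2 gives a3/a0 = (a1/a0)(a2/a0). *)
move: (one_unitsM b01 b02); rewrite !invf_div [X in X - 1](_ : _ =
  a 3 / a 0) //.
apply: (mulIf (a0 0)); rewrite divfK //; apply: (mulIf (a0 0)).
by rewrite [RHS]mulrC a0312; field; rewrite !a0.
Qed.

Theorem intertwines_Hprime y : intertwines y -> Hprime varpi t y.
Proof.
move=> hy; have [k1 [k2 [kk1 kk2 mon]]] := Kprime_monomial y.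
have hw := intertwines_Kprime kk1 kk2 hy.
set w := (k1 * y * k2)%g in mon hw.
suff [hh|[h hh e]] : Hprime varpi t w.
- left; rewrite (_ : y = k1^-1 * w * k2^-1)%g; last first.
    by rewrite /w !mulgA mulVg mul1g mulgK.
  by apply: HgrpM; [apply: HgrpM => //|]; apply/HgrpV/Kprime_Hgrp.
- rewrite (_ : y = k1^-1 * w * k2^-1)%g; last first.
    by rewrite /w !mulgA mulVg mul1g mulgK.
  apply: HprimeM => //; last exact/Hprime_Hgrp/HgrpV/Kprime_Hgrp.
  apply: HprimeM => //; first exact/Hprime_Hgrp/HgrpV/Kprime_Hgrp.
  by right; exists h.
clearbody w; have [p wp] := choice mon.
have p3 : p 3 = rev_ord (p 0) by rewrite -(monomial_rev wp) rev4E.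
have p2 : p 2 = rev_ord (p 1) by rewrite -(monomial_rev wp) rev4E.
have [[p0 p1]|[p0 p1]] := monomial_perm wp hw.
  left; apply: diagonal_intertwines hw => i j ij; apply: wp.
  have -> // : p j = j.
  by elim/I4P: j {ij}; rewrite ?p2 ?p3 ?p0 ?p1 //; apply: val_inj.
apply/HprimeP; right; apply: diagonal_intertwines; last exact: intertwines_gchi.
(* [gchi^-1] is a central multiple of [gchi], so zero entries can be computed with the explicit
   matrix of [gchi]. *)
have gw i j : (gchi * w)%g i j = 0 -> (gchi^-1 * w)%g i j = 0.
  move=> h.
  rewrite (_ : gchi^-1 = (gchi * gchi)^-1 * gchi)%g;
    last by rewrite invgM mulgVK.
  have /centerGP[c c0 cE] := centerV (gchi_sqr hvarpi ht).
  by rewrite -mulgA (scalar_mulE _ cE) h mulr0.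
move=> i j ij; apply: gw; rewrite gsp4_mulE sum4 (gchiE hvarpi ht) !mxE.
move: ij; elim/I4P: i; elim/I4P: j => //= _;
  rewrite ?(mul0r, add0r, addr0) wp ?mulr0 // ?p2 ?p3 ?p0 ?p1 //.
Qed.

End Intertwining.

(** * Topology of Z\G *)

Section Topology.
Variable F : nonarchLocalFieldType.
Implicit Types (g h x y z : GSp4 F) (S : set (GSp4 F)).

Definition gball (n : int) g : set (GSp4 F) :=
  [set x | forall i j, pideal F n (x i j - g i j)].

Lemma nbhs_gball n g : nbhs g (gball n g).
Proof.
pose B : set 'M[F]_4 := [set M | forall i j, pideal F n (M i j - g i j)].
have nB : nbhs (g : 'M[F]_4) B.
  exists (fun i j => [set u | pideal F n (u - g i j)]) => // i j.
  by rewrite nbhs_valuation; exists n.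
exact: (@initial_continuous _ _ (@gsp4_mx F) g B nB).
Qed.

Lemma nbhs_gballP g S : nbhs g S <-> exists n, gball n g `<=` S.
Proof.
split=> [|[n]]; last by move=> h; apply: filterS h _; apply: nbhs_gball.
rewrite nbhsE => -[U [[A oA <-] /= Ag] US].
have : nbhs (g : 'M[F]_4) A by apply: open_nbhs_nbhs; split.
move=> [P nP PA]; have h (ij : 'I_4 * 'I_4) : exists n : int,
    forall u, pideal F n (u - g ij.1 ij.2) -> P ij.1 ij.2 u.
  by have := nP ij.1 ij.2; rewrite nbhs_valuation => -[n _ hn]; exists n => u;
    apply: hn.
have [N hN] := choice h.
pose n := (\sum_ij `|N ij|%N)%N; exists n%:Z => x xg; apply: US => /=.
apply: PA => i j; apply: (hN (i, j)); apply: pideal_le (xg i j).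
by rewrite /n (bigD1 (i, j)) //=; lia.
Qed.

Lemma gball_lmul n h g : exists m, forall x, gball m g x -> gball n (h * g)%g
  (h * x)%g.
Proof.
have hN i j : exists n, pideal F n (h i j) by apply: pideal_exists.
have [N hNP] := choice (fun ij : 'I_4 * 'I_4 => hN ij.1 ij.2).
pose m := (\sum_ij `|N ij|%N)%N; exists (n + m%:Z) => x xg i j.
rewrite !gsp4_mulE -sumrB; apply: pideal_sum => l _; rewrite -mulrBr.
apply: pideal_le (pidealM (hNP (i, l)) (xg l j)).
by rewrite /m (bigD1 (i, l)) //=; lia.
Qed.

Lemma gball_rmul n h g : exists m, forall x, gball m g x -> gball n (g * h)%g
  (x * h)%g.
Proof.
have hN i j : exists n, pideal F n (h i j) by apply: pideal_exists.
have [N hNP] := choice (fun ij : 'I_4 * 'I_4 => hN ij.1 ij.2).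
pose m := (\sum_ij `|N ij|%N)%N; exists (n + m%:Z) => x xg i j.
rewrite !gsp4_mulE -sumrB; apply: pideal_sum => l _; rewrite -mulrBl.
apply: pideal_le (pidealM (xg i l) (hNP (l, j))).
by rewrite /m (bigD1 (l, j)) //=; lia.
Qed.

Lemma nbhs_lmul h g S : nbhs (h * g)%g S -> nbhs g [set x | S (h * x)%g].
Proof.
move=> /nbhs_gballP[n nS]; have [m hm] := gball_lmul n h g.
by apply/nbhs_gballP; exists m => x /hm; apply: nS.
Qed.

Lemma nbhs_rmul h g S : nbhs (g * h)%g S -> nbhs g [set x | S (x * h)%g].
Proof.
move=> /nbhs_gballP[n nS]; have [m hm] := gball_rmul n h g.
by apply/nbhs_gballP; exists m => x /hm; apply: nS.
Qed.

Lemma nbhs1_Kprime : nbhs (1%g : GSp4 F) (@Kprime F).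
Proof.
apply/nbhs_gballP; exists 1 => x hx; apply/KprimeP => i j.
rewrite -gsp4_oneE; apply: pideal_le (hx i j); exact: wt_le1.
Qed.

Lemma open_subgroup S : (forall g h, S g -> S h -> S (g * h)%g) ->
  (forall k, Kprime k -> S k) -> open S.
Proof.
move=> SM SK; rewrite openE => g Sg; rewrite /interior.
have := @nbhs_lmul g^-1%g g (@Kprime F); rewrite mulVg => /(_ nbhs1_Kprime).
by apply: filterS => x /SK /(SM _ _ Sg); rewrite mulVKg.
Qed.

Lemma open_rtranslate S g : open S -> open [set x | S (x * g)%g].
Proof.
rewrite !openE => oS x Sx; rewrite /interior.
by have := @nbhs_rmul g x S (oS _ Sx).
Qed.

Lemma open_ltranslate S g : open S -> open [set x | S (g * x)%g].
Proof.
rewrite !openE => oS x Sx; rewrite /interior.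
by have := @nbhs_lmul g x S (oS _ Sx).
Qed.

(** With T := Prop this also covers subsets of G. *)
Definition Zinvariant (T : Type) (f : GSp4 F -> T) :=
  forall z g, centerG F z -> f (z * g)%g = f g.

Lemma piZP g h : piZ g = piZ h <-> exists2 z, centerG F z & h = (z * g)%g.
Proof.
have -> : (piZ g = piZ h) = (g = h %[mod {eq_quot (@eqmodZ F)}])%qT by [].
by split=> [/eqmodP/asboolP//|e]; apply/eqmodP/asboolP.
Qed.

Lemma piZ_repr (u : ZG F) : piZ (repr u) = u.
Proof. exact: reprK. Qed.

Lemma repr_piZ g : exists2 z, centerG F z & repr (piZ g) = (z * g)%g.
Proof. by apply/piZP; rewrite piZ_repr. Qed.

Lemma piZ_center z g : centerG F z -> piZ (z * g)%g = piZ g.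
Proof. by move=> cz; symmetry; apply/piZP; exists z. Qed.

Lemma descendE (T : Type) (f : GSp4 F -> T) g :
  Zinvariant f -> descend f (piZ g) = f g.
Proof. by move=> fZ; rewrite /descend; have [z cz ->] := repr_piZ g; apply: fZ.
  Qed.

Lemma image_piZ S g : Zinvariant S -> (@piZ F @` S) (piZ g) = S g.
Proof.
move=> SZ; apply/propext; split=> [[h Sh /piZP[z cz ->]]|Sg]; last by exists g.
by rewrite SZ.
Qed.

Lemma open_piZ S : Zinvariant S -> open S -> open (@piZ F @` S).
Proof.
move=> SZ oS; rewrite -[open _]/(open (@piZ F @^-1` (@piZ F @` S))).
rewrite [X in open X](_ : _ = S) //.
by apply/funext => g; rewrite -[LHS]/((@piZ F @` S) (piZ g)) image_piZ.
Qed.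

Lemma measurable_open (U : set (ZG F)) : open U -> measurable (U : set (borelZG
  F)).
Proof. exact: (@sub_sigma_algebra _ setT (@open (ZG F)) U). Qed.

Lemma measurable_piZ S : Zinvariant S -> open S ->
  measurable (@piZ F @` S : set (borelZG F)).
Proof. by move=> SZ oS; apply: measurable_open; apply: open_piZ. Qed.

Lemma Zinvariant_Hgrp : Zinvariant (@Hgrp F).
Proof.
move=> z g cz; apply/propext; split=> h; last exact: HgrpM (center_Hgrp cz) h.
by rewrite -(mulKg z g); apply: HgrpM h; apply/HgrpV/center_Hgrp.
Qed.

Lemma open_Hgrp : open (@Hgrp F).
Proof. by apply: open_subgroup; [exact: HgrpM|exact: Kprime_Hgrp]. Qed.

Lemma smooth_preimage (R : realType) (f : GSp4 F -> R[i]) (B : set R[i]) :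
  smooth f -> open (f @^-1` B).
Proof.
move=> sf; rewrite openE => g Bg; rewrite /interior.
by apply: filterS (sf g) => x /= ->.
Qed.

(** A locally constant function has open preimages of arbitrary sets, so p may be any map. *)
Lemma measurable_descend (R : realType) (f : GSp4 F -> R[i]) d
    (T : measurableType d) (p : R[i] -> T) : smooth f -> Zinvariant f ->
  measurable_fun setT (fun u : borelZG F => p (descend f u)).
Proof.
move=> sf fZ _ B _; rewrite setTI.
rewrite (_ : _ @^-1` B = @piZ F @` (f @^-1` (p @^-1` B))).
  apply: measurable_piZ; last exact: smooth_preimage.
  by move=> z g cz; rewrite /preimage /= fZ.
apply/seteqP; split=> u; rewrite /preimage /=; last first.
  by move=> [g] + <-; rewrite descendE.
by move=> h; exists (repr u); [exact: h|exact: piZ_repr].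
Qed.

End Topology.

(** * Integration on Z\G *)

Section Integration.
Variables (R : realType) (F : nonarchLocalFieldType).
Variables (mu : {measure set (borelZG F) -> \bar R}) (hmu : haar_measure mu).
Implicit Types (g h x y z : GSp4 F) (S : set (GSp4 F)) (f : GSp4 F -> R[i]).
Local Open Scope complex_scope.

Definition lshift y (u : borelZG F) : borelZG F := piZ (y * repr (u : ZG F))%g.

Lemma lshift_piZ y g : lshift y (piZ g) = piZ (y * g)%g.
Proof.
rewrite /lshift; have [z cz ->] := repr_piZ g.
by rewrite mulgA -(cz y) -mulgA (piZ_center _ cz).
Qed.

Lemma lshift_open y (U : set (ZG F)) : open U -> open (lshift y @^-1` U).
Proof.
move=> oU; have oU' : open (@piZ F @^-1` U) by [].
rewrite -[open _]/(open (@piZ F @^-1` (lshift y @^-1` U))).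
rewrite [X in open X](_ : _ = [set x | (@piZ F @^-1` U) (y * x)%g]).
  exact: open_ltranslate.
by apply/funext => g; rewrite /preimage /= lshift_piZ.
Qed.

Lemma measurable_lshift y : measurable_fun setT (lshift y).
Proof.
apply: (@measurability _ _ _ _ setT (lshift y) (@open (ZG F))) =>
  // _ [B oB <-].
by rewrite setTI; apply: measurable_open; apply: lshift_open.
Qed.

HB.instance Definition _ y :=
  isMeasurableFun.Build _ _ _ _ (lshift y) (measurable_lshift y).

Lemma lshiftK y u : lshift y^-1%g (lshift y u) = u.
Proof.
rewrite -[u](piZ_repr (u : ZG F)) !lshift_piZ. by rewrite mulKg.
Qed.

Lemma lshiftVK y u : lshift y (lshift y^-1%g u) = u.
Proof. by rewrite -{1}[y]invgK lshiftK. Qed.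

(** Haar invariance is given for images; the preimage under translation by y is the image under
    translation by y^-1. *)
Lemma mu_lshift y (A : set (borelZG F)) :
  measurable A -> mu (lshift y @^-1` A) = mu A.
Proof.
move=> mA; case: hmu => _ /(_ y^-1%g A mA) <- _; congr (mu _).
apply/seteqP; split=> u; rewrite /preimage /=.
  by move=> Au; exists (lshift y u); [|exact: lshiftK].
by move=> [w Aw <-]; rewrite -[piZ _]/(lshift y^-1%g w) lshiftVK.
Qed.

Lemma mu_ltranslate y S : Zinvariant S -> open S ->
  mu (@piZ F @` [set x | S (y * x)%g]) = mu (@piZ F @` S).
Proof.
move=> SZ oS; rewrite -(mu_lshift y (measurable_piZ SZ oS)); congr (mu _).
apply/seteqP; split=> u; rewrite /preimage /=.
  by move=> [g Sg <-]; exists (y * g)%g; rewrite ?lshift_piZ.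
move=> [g Sg e]; exists (y^-1 * g)%g; first by rewrite /= mulVKg.
by rewrite -lshift_piZ e lshiftK.
Qed.

Lemma mu_rtranslate y S : Zinvariant S -> open S ->
  mu (@piZ F @` [set x | S (x * y)%g]) = mu (@piZ F @` S).
Proof.
move=> SZ oS; case: hmu => _ _ /(_ y^-1%g _ (measurable_piZ SZ oS)) <-.
congr (mu _); apply/seteqP; split=> u /=.
  move=> [g Sg <-]; exists (piZ (g * y)%g); first by exists (g * y)%g.
  by have [z cz ->] := repr_piZ (g * y)%g; rewrite -mulgA mulgK (piZ_center _
    cz).
move=> [w [g Sg <-] <-]; exists (g * y^-1)%g; first by rewrite /= mulgVK.
by have [z cz ->] := repr_piZ g; rewrite -mulgA (piZ_center _ cz).
Qed.

(** * A class of integrable functions stable under translation and linear combination *)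

Definition admissible f := [/\ smooth f, Zinvariant f,
  exists M : R, forall g, Normc.normc (f g) <= M &
  exists A : set (borelZG F), [/\ measurable A, (mu A < +oo)%E &
    forall g, f g != 0 -> A (piZ g)]].

Definition intZG f : R[i] := integralC mu (descend f).

Lemma normc_Re (z : R[i]) : `|complex.Re z| <= Normc.normc z.
Proof.
case: z => a b /=; rewrite -sqrtr_sqr ler_wsqrtr // lerDl; exact: sqr_ge0.
Qed.

Lemma normc_Im (z : R[i]) : `|complex.Im z| <= Normc.normc z.
Proof.
case: z => a b /=; rewrite -sqrtr_sqr ler_wsqrtr // lerDr; exact: sqr_ge0.
Qed.

Lemma normc_nonneg (z : R[i]) : 0 <= Normc.normc z.
Proof. by case: z => a b; apply: sqrtr_ge0. Qed.

Lemma admissible_integrable f (p : R[i] -> R) : admissible f ->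
  (forall c, `|p c| <= Normc.normc c) ->
  mu.-integrable setT (fun u => (p (descend f u))%:E).
Proof.
move=> [sf fZ [M fM] [A [mA Afin fA]]] hp.
have mf : measurable_fun setT (fun u : borelZG F => p (descend f u)).
  exact: measurable_descend.
pose G : borelZG F -> \bar R := fun u => (M * \1_A u)%:E.
have iG : mu.-integrable setT G.
  apply/integrableP; split.
    by apply/measurable_EFinP; apply: measurable_funM => //.
  rewrite (eq_integral (fun u => `|M|%:E * (\1_A u)%:E)%E); last first.
    move=> u _; rewrite /G /= normrM -EFinM; congr (_ * _)%:E.
    by rewrite ger0_norm.
  rewrite ge0_integralZl //.
    by rewrite integral_indic // setIT lte_mul_pinfty.
  by apply/measurable_EFinP; apply: measurable_indic.
apply: le_integrable iG => //; first exact/measurable_EFinP.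
move=> u _; rewrite /G lee_fin; apply: le_trans (ler_norm _).
rewrite -[u](piZ_repr (u : ZG F)) descendE // indicE.
case: (boolP (_ \in A)) => [_|/negP Au].
  by rewrite mulr1 (le_trans (hp _)).
rewrite mulr0; have -> : f (repr (u : ZG F)) = 0.
  apply/eqP/negPn/negP => /fA h; apply: Au; exact: mem_set.
by rewrite (le_trans (hp _)) // Normc.normc0.
Qed.

Lemma admissible_lmul y f : admissible f -> admissible (fun x => f (y * x)%g).
Proof.
move=> [sf fZ [M fM] [A [mA Afin fA]]]; split.
- by move=> g; have := nbhs_lmul (sf (y * g)%g).
- by move=> z g cz; rewrite mulgA -(cz y) -mulgA (fZ z).
- by exists M => g; apply: fM.
exists (lshift y @^-1` A); split.
- by have := measurable_lshift y measurableT mA; rewrite setTI.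
- by rewrite mu_lshift.
- by move=> g /fA; rewrite /preimage /= lshift_piZ.
Qed.

Lemma intZG_lmul y f : admissible f -> intZG (fun x => f (y * x)%g) = intZG f.
Proof.
move=> af; have [_ fZ _ _] := af.
have e u : descend (fun x => f (y * x)%g) u = descend f (lshift y u).
  by rewrite /lshift descendE.
have P p : (forall c, `|p c| <= Normc.normc c) ->
    \int[mu]_u p (descend (fun x => f (y * x)%g) u) =
      \int[mu]_u p (descend f u).
  move=> hp; rewrite /Rintegral; congr fine.
  have ip := admissible_integrable af hp.
  have mf : measurable_fun setT (fun u : borelZG F => (p (descend f u))%:E).
    by have /integrableP[] := ip.
  have ip' := admissible_integrable (admissible_lmul y af) hp.
  have -> : (\int[mu]_u (p (descend f u))%:E =
      \int[pushforward mu (lshift y)]_u (p (descend f u))%:E)%E.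
    apply: (eq_measure_integral (pushforward mu (lshift y))) => A mA _.
    exact: (esym (mu_lshift y mA)).
  rewrite (integral_pushforward (measurable_lshift y) mf) ?preimage_setT //.
    by apply: eq_integral => u _; rewrite /= e.
  by apply: eq_integrable ip' => // u _; rewrite /= e.
by rewrite /intZG /integralC !P //; [exact: normc_Im|exact: normc_Re].
Qed.

Lemma admissibleD f1 f2 : admissible f1 -> admissible f2 ->
  admissible (fun x => f1 x + f2 x).
Proof.
move=> [sf fZ [M fM] [A [mA Afin fA]]] [sg gZ [N gN] [B [mB Bfin gB]]]; split.
- by move=> g; apply: filterS2 (sf g) (sg g) => x -> ->.
- by move=> z g cz; rewrite fZ // gZ.
- exists (M + N) => g.
  by apply: le_trans (le_normcD _ _) _; apply: lerD.
exists (A `|` B); split; first exact: measurableU.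
  apply: le_lt_trans (measureU2 _ mA mB) _.
  by rewrite lte_add_pinfty.
move=> g; case: (eqVneq (f1 g) 0) => [->|/fA]; last by left.
by rewrite add0r => /gB; right.
Qed.

Lemma admissibleZ (c : R[i]) f : admissible f -> admissible (fun x => c * f x).
Proof.
move=> [sf fZ [M fM] [A [mA Afin fA]]]; split.
- by move=> g; have := sf g; apply: filterS => x /= ->.
- by move=> z g cz; rewrite fZ.
- exists (Normc.normc c * M) => g; rewrite Normc.normcM ler_wpM2l //.
  exact: normc_nonneg.
exists A; split=> // g; rewrite mulf_eq0 negb_or => /andP[_]; exact: fA.
Qed.

Lemma intZG_add f1 f2 : admissible f1 -> admissible f2 ->
  intZG (fun x => f1 x + f2 x) = intZG f1 + intZG f2.
Proof.
move=> a1 a2; rewrite /intZG /integralC.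
have := RintegralD measurableT (admissible_integrable a1 normc_Re)
  (admissible_integrable a2 normc_Re).
have := RintegralD measurableT (admissible_integrable a1 normc_Im)
  (admissible_integrable a2 normc_Im).
rewrite /= => eI eR; apply/eqP; rewrite eq_complex /= -eI -eR; apply/andP;
  split.
  by apply/eqP/eq_Rintegral => u _; rewrite /descend; case: (f1 _) (f2 _) =>
    a b [].
by apply/eqP/eq_Rintegral => u _; rewrite /descend; case: (f1 _) (f2 _) =>
  a b [].
Qed.

Lemma intZG_scale (c : R[i]) f : admissible f -> intZG (fun x => c * f x) =
  c * intZG f.
Proof.
move=> af; rewrite /intZG /integralC.
have iR := admissible_integrable af normc_Re.
have iI := admissible_integrable af normc_Im.
have sR (a : R) : mu.-integrable setT (EFin \o (fun u =>
  a * complex.Re (descend f u))).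
  by apply: eq_integrable (integrableZl measurableT a iR).
have sI (a : R) : mu.-integrable setT (EFin \o (fun u =>
  a * complex.Im (descend f u))).
  by apply: eq_integrable (integrableZl measurableT a iI).
case: c => a b; apply/eqP; rewrite eq_complex /=; apply/andP; split.
  rewrite -!RintegralZl // -(RintegralB measurableT (sR a) (sI b)).
  by apply/eqP/eq_Rintegral => u _; rewrite /descend; case: (f _).
rewrite -!RintegralZl // -(RintegralD measurableT (sI a) (sR b)).
by apply/eqP/eq_Rintegral => u _; rewrite /descend; case: (f _).
Qed.

Lemma intZG0 : intZG (fun=> 0) = 0.
Proof.
rewrite /intZG /integralC /descend /= /Rintegral integral0 /=.
by apply/eqP; rewrite eq_complex /= eqxx.
Qed.

Lemma admissible0 : admissible (fun=> 0).
Proof.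
split=> //; first by move=> g; apply: filterE.
  by exists 0 => g; rewrite Normc.normc0.
exists set0; split=> //; first by rewrite measure0.
by move=> g; rewrite eqxx.
Qed.

Lemma admissible_sum (I : Type) (r : seq I) (f : I -> GSp4 F -> R[i]) :
  (forall i, admissible (f i)) -> admissible (fun x => \sum_(i <- r) f i x).
Proof.
move=> af; elim: r => [|i r IHr].
  rewrite (_ : (fun _ => _) = fun=> 0); first exact: admissible0.
  by apply/funext => x; rewrite big_nil.
rewrite (_ : (fun _ => _) = fun x => f i x + \sum_(j <- r) f j x).
  exact: admissibleD.
by apply/funext => x; rewrite big_cons.
Qed.

Lemma intZG_sum (I : Type) (r : seq I) (f : I -> GSp4 F -> R[i]) :
  (forall i, admissible (f i)) ->
  intZG (fun x => \sum_(i <- r) f i x) = \sum_(i <- r) intZG (f i).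
Proof.
move=> af; elim: r => [|i r IHr].
  rewrite big_nil -[RHS]intZG0; congr (intZG _); apply/funext => x.
  by rewrite big_nil.
rewrite big_cons -IHr -intZG_add //; last exact: admissible_sum.
by congr (intZG _); apply/funext => x; rewrite big_cons.
Qed.

End Integration.

(** * Formal degree of an induced character *)

Section InducedCharacter.
Variables (R : realType) (F : nonarchLocalFieldType).
Variables (mu : {measure set (borelZG F) -> \bar R}) (hmu : haar_measure mu).
Variables (S : set (GSp4 F)) (theta : GSp4 F -> R[i]) (V : R).
Local Open Scope complex_scope.
Hypotheses (oS : open S) (SZ : forall z, centerG F z -> S z)
  (SM : forall g h, S g -> S h -> S (g * h)%g)
  (SV : forall g, S g -> S (g^-1)%g)
  (theta_norm : forall g, S g -> theta g * (theta g)^*%R = 1)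
  (theta_center : forall z, centerG F z -> theta z = 1)
  (V_neq0 : V != 0) (muS : mu (@piZ F @` S) = V%:E)
  (no_intertwining : forall y, ~ S y ->
    exists k, [/\ S k, S (y * k * y^-1)%g & theta (y * k * y^-1)%g != theta k]).
Implicit Types (g h x y z a b : GSp4 F) (f v : GSp4 F -> R[i]).

Lemma conjcM (c d : R[i]) : (c * d)^*%R = c^*%R * d^*%R.
Proof. exact: rmorphM. Qed.

Definition right_coset a : set (GSp4 F) := [set g | S (g * a^-1)%g].

Lemma group1S : S 1%g.
Proof. exact: SZ (@center1 F). Qed.

Lemma coset_refl a : right_coset a a.
Proof. by rewrite /right_coset /= mulgV; apply: group1S. Qed.

Lemma coset_trans a b g : right_coset a b -> right_coset b g -> right_coset a g.
Proof. by rewrite /right_coset /= => h1 h2; have := SM h2 h1;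
  rewrite mulgA mulgVK. Qed.

Lemma coset_sym a b : right_coset a b -> right_coset b a.
Proof. by rewrite /right_coset /= => /SV; rewrite invgM invgK. Qed.

Lemma coset_Zinv a : Zinvariant (right_coset a).
Proof.
move=> z g cz; apply/propext; rewrite /right_coset /= -mulgA; split; last first.
  by apply: SM; apply: SZ.
by move=> h; have := SM (SV (SZ cz)) h; rewrite mulKg.
Qed.

Lemma open_coset a : open (right_coset a).
Proof. exact: open_rtranslate. Qed.

(** The coset Sa is a right translate of S, so right invariance applies. *)
Lemma mu_coset a : mu (@piZ F @` right_coset a) = V%:E.
Proof.
rewrite -muS; apply: mu_rtranslate => //.
by have := @coset_Zinv 1%g; rewrite /Zinvariant /right_coset /= => h z g cz;
  have := h z g cz; rewrite invg1 !mulg1.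
Qed.

Lemma finite_cosets (C : set (ZG F)) : compact C ->
  exists s : seq (GSp4 F), [/\ uniq s,
    {in s &, forall a b, right_coset a b -> a = b} &
    forall g, C (piZ g) -> exists2 a, a \in s & right_coset a g].
Proof.
rewrite compact_cover => /(_ _ setT (fun a => @piZ F @` right_coset a)).
case=> [a _|u _|D _ CD].
- by apply: open_piZ; [exact: coset_Zinv|exact: open_coset].
- exists (repr u) => //; exists (repr u); first exact: coset_refl.
  exact: piZ_repr.
(* [get] depends only on the coset as a set, so equal cosets receive equal representatives and
   [undup] removes the repetitions. *)
pose rep a := get (right_coset a).
have repP a : right_coset a (rep a) by apply: (@getPex _ (right_coset a));
  exists a; apply: coset_refl.
have repE a b : right_coset a b -> rep a = rep b.
  move=> ab; congr get; apply/seteqP; split=> g; apply: coset_trans => //.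
  exact: coset_sym.
exists (undup (map rep (finmap.enum_fset D))); split; first exact: undup_uniq.
  move=> a b; rewrite !mem_undup => /mapP[c _ ->] /mapP[d _ ->] h.
  apply: repE; apply: coset_trans (repP c) _; apply: coset_trans h _.
  exact/coset_sym/repP.
move=> g /CD[a /= aD [h ah /piZP[z cz e]]].
exists (rep a); first by rewrite mem_undup; apply: map_f.
apply: coset_trans (coset_sym (repP a)) _.
by rewrite e coset_Zinv.
Qed.

Definition coset_indic a g : R[i] := `[< right_coset a g >]%:R.

Lemma coset_indic_smooth a : smooth (coset_indic a).
Proof.
move=> g; have : nbhs g (right_coset g).
  by apply: open_nbhs_nbhs; split; [exact: open_coset|exact: coset_refl].
apply: filterS => x gx; rewrite /coset_indic; congr ((_ : bool)%:R).
apply/asbool_equiv_eq; split=> h; first exact: coset_trans h (coset_sym gx).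
exact: coset_trans h gx.
Qed.

Lemma admissible_indic a : admissible mu (coset_indic a).
Proof.
split; first exact: coset_indic_smooth.
- by move=> z g cz; rewrite /coset_indic coset_Zinv.
- exists 1 => g; rewrite /coset_indic; case: asboolP => _;
  first by rewrite Normc.normc1.
  by rewrite Normc.normc0.
exists (@piZ F @` right_coset a); split.
- by apply: measurable_piZ; [exact: coset_Zinv|exact: open_coset].
- by rewrite mu_coset ltry.
- move=> g; rewrite /coset_indic; case: asboolP => [h _|_];
  last by rewrite eqxx.
  by exists g.
Qed.

Lemma intZG_indic a : intZG mu (coset_indic a) = V%:C.
Proof.
have mA := measurable_piZ (@coset_Zinv a) (open_coset a).
rewrite /intZG /integralC; apply/eqP; rewrite eq_complex /=; apply/andP; split.
  apply/eqP; transitivity (\int[mu]_u \1_(@piZ F @` right_coset a : set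
    (borelZG F)) u : R).
    apply: eq_Rintegral => u _; rewrite indicE /descend /coset_indic.
    rewrite -[in RHS](piZ_repr (u : ZG F)).
    rewrite (_ : (piZ (repr u) \in _) = `[< right_coset a (repr (u : ZG F)) >]).
      by case: asboolP.
    have iE := image_piZ (repr (u : ZG F)) (@coset_Zinv a).
    by apply/idP/asboolP => [/set_mem|h]; [rewrite iE|apply/mem_set;
      rewrite iE].
  by rewrite /Rintegral integral_indic // setIT mu_coset.
apply/eqP; rewrite /Rintegral (eq_integral (cst 0%E));
  first by rewrite integral0.
by move=> u _; rewrite /descend /coset_indic; case: asboolP.
Qed.

Section Vector.
Variable s : seq (GSp4 F).
Hypotheses (us : uniq s) (sinj : {in s &, forall a b, right_coset a b -> a =
  b}).

(** Such an f is a finite combination of coset indicators, each of integral V. *)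
Lemma intZG_invariant f : (forall h g, S h -> f (h * g)%g = f g) ->
  (forall g, f g != 0 -> exists2 a, a \in s & right_coset a g) ->
  intZG mu f = V%:C * \sum_(a <- s) f a.
Proof.
move=> fS fs; rewrite (_ : f = fun g => \sum_(a <- s) f a * coset_indic a g).
  rewrite intZG_sum => [|a]; last by apply: admissibleZ;
    apply: admissible_indic.
  rewrite mulr_sumr; apply: eq_big_seq => a sa.
  rewrite intZG_scale ?intZG_indic; last exact: admissible_indic.
  rewrite mulrC; congr (_ * _); rewrite (bigD1_seq a) //= big1_seq ?addr0.
    by rewrite /coset_indic; case: asboolP => [_|[]];
      [rewrite mulr1|exact: coset_refl].
  move=> b /andP[ba sb]; rewrite /coset_indic; case: asboolP => [h|_];
    last by rewrite mulr0.
  by rewrite (sinj sb sa h) eqxx in ba.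
apply/funext => g.
have [[a sa ag]|h] := pselect (exists2 a, a \in s & right_coset a g).
  rewrite (bigD1_seq a) //= big1_seq ?addr0.
    rewrite /coset_indic; case: asboolP => [_|[]//]; rewrite mulr1.
    by rewrite -[g](mulgVK a) fS.
  move=> b /andP[ba sb]; rewrite /coset_indic; case: asboolP => [bg|_];
    last by rewrite mulr0.
  by rewrite (sinj sb sa (coset_trans bg (coset_sym ag))) eqxx in ba.
rewrite big1_seq => [|b sb].
  by apply/eqP/negPn/negP => /fs.
rewrite /coset_indic; case: asboolP => [bg|_]; last by rewrite mulr0.
by case: h; exists b.
Qed.

Variable v : GSp4 F -> R[i].
Hypotheses (vs : smooth v)
  (vS : forall h g, S h -> v (h * g)%g = theta h * v g)
  (vsupp : forall g, v g != 0 -> exists2 a, a \in s & right_coset a g).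

Lemma theta_normc h : S h -> Normc.normc (theta h) = 1.
Proof.
move=> /theta_norm /(congr1 (@Normc.normc R));
  rewrite Normc.normcM Normc.normc1.
have -> : Normc.normc (theta h)^*%R = Normc.normc (theta h).
  by case: (theta h) => a b /=; rewrite sqrrN.
have n0 := normc_nonneg (theta h).
by rewrite -expr2 => /eqP; rewrite pexpr_eq1 // => /eqP.
Qed.

Lemma support_finite : exists A : set (borelZG F), [/\ measurable A,
  (mu A < +oo)%E & forall a g, a \in s -> right_coset a g -> A (piZ g)].
Proof.
elim: s => [|a r [A [mA Afin hA]]].
  by exists set0; split=> //; rewrite measure0.
exists ((@piZ F @` right_coset a) `|` A); have mC :=
  measurable_piZ (@coset_Zinv a) (open_coset a).
have Cfin : (mu (@piZ F @` right_coset a) < +oo)%E by rewrite mu_coset ltry.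
split; first exact: measurableU.
  apply: le_lt_trans (measureU2 _ mC mA) _.
  exact: lte_add_pinfty.
move=> b g; rewrite inE => /orP[/eqP ->|br] bg; first by left; exists g.
by right; apply: hA bg.
Qed.

Lemma admissible_vector : admissible mu v.
Proof.
split=> //.
- by move=> z g cz; rewrite vS ?theta_center ?mul1r //; apply: SZ.
(* By unitarity |v| is constant on each coset, so the sum of its values at the representatives is a
   bound. *)
- exists (\sum_(a <- s) Normc.normc (v a)) => g.
  have [->|/vsupp[a sa ag]] := eqVneq (v g) 0.
    by rewrite Normc.normc0; apply: sumr_ge0 => *; apply: normc_nonneg.
  rewrite -[g](mulgVK a) vS // Normc.normcM theta_normc // mul1r.
  rewrite (bigD1_seq a) //= lerDl.
  by apply: sumr_ge0 => *; apply: normc_nonneg.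
have [A [mA Afin hA]] := support_finite.
by exists A; split=> // g /vsupp[a sa ag]; apply: hA sa ag.
Qed.

Lemma admissible_mulJ f1 f2 : admissible mu f1 -> admissible mu f2 ->
  admissible mu (fun x => f1 x * (f2 x)^*%R).
Proof.
move=> [sf fZ [M fM] [A [mA Afin fA]]] [sg gZ [N gN] _]; split.
- by move=> g; apply: filterS2 (sf g) (sg g) => x -> ->.
- by move=> z g cz; rewrite fZ // gZ.
- exists (M * N) => g; rewrite Normc.normcM.
  apply: ler_pM => //; try exact: normc_nonneg.
  by have := gN g; case: (f2 g) => a b /=; rewrite sqrrN.
by exists A; split=> // g; rewrite mulf_eq0 negb_or => /andP[/fA].
Qed.

Lemma admissible_convolution y : admissible mu (fun x =>
  v (y * x)%g * (v x)^*%R).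
Proof.
apply: admissible_mulJ; last exact: admissible_vector.
exact: (admissible_lmul hmu _ admissible_vector).
Qed.

Lemma convolution_notin y : ~ S y -> intZG mu (fun x =>
  v (y * x)%g * (v x)^*%R) = 0.
Proof.
move=> /no_intertwining[k [Sk Syk neq]].
have e := intZG_lmul hmu k (admissible_convolution y).
set c := theta (y * k * y^-1)%g * (theta k)^*%R.
have cE : intZG mu (fun x => v (y * (k * x))%g * (v (k * x)%g)^*%R) =
    c * intZG mu (fun x => v (y * x)%g * (v x)^*%R).
  rewrite -intZG_scale; last exact: admissible_convolution.
  congr (intZG _ _); apply/funext => x; rewrite (vS _ Sk).
  have -> : (y * (k * x) = y * k * y^-1 * (y * x))%g by rewrite !mulgA mulgVK.
  by rewrite (vS _ Syk) conjcM /c mulrACA.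
move: e; rewrite cE => /eqP; rewrite -subr_eq0 -[X in _ - X]mul1r -mulrBl.
(* The integral equals c times itself; c = 1 would mean theta(y k y^-1) = theta(k), as theta(k) has
   inverse its conjugate. *)
rewrite mulf_eq0 => /orP[|/eqP //]; rewrite subr_eq0 => /eqP c1.
move: neq; rewrite -[theta (y * k * y^-1)%g]mulr1 -(theta_norm Sk).
by rewrite (mulrC (theta k)) mulrA -/c c1 mul1r eqxx.
Qed.

Lemma innerE x :
  inner mu S v (right_translation x v) = \sum_(a <- s) v a * (v (a * x)%g)^*%R.
Proof.
rewrite /inner muS /= -[integralC _ _]/(intZG mu _) (@intZG_invariant (fun g =>
  v g * (right_translation x v g)^*%R)).
- by rewrite mulrA -rmorphM mulVf // rmorph1 mul1r.
- move=> h g Sh; rewrite /right_translation -mulgA !(vS _ Sh).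
  rewrite conjcM mulrACA.
  by rewrite theta_norm // mul1r.
- by move=> g; rewrite mulf_eq0 negb_or => /andP[/vsupp].
Qed.

Lemma formal_degree_vector :
  let coeff := descend
    (fun x => Normc.normc (inner mu S v (right_translation x v)) ^+ 2) in
  mu.-integrable setT (fun u => (coeff u)%:E) /\
  (V^-1 * \int[mu]_u coeff u)%:C = inner mu S v v ^+ 2.
Proof.
pose G x := \sum_(a <- s) \sum_(b <- s)
  (v a * (v b)^*%R) * (v (b * x)%g * (v (a * x)%g)^*%R).
have GE x : (Normc.normc (inner mu S v (right_translation x v)) ^+ 2)%:C = G x.
  set c := inner _ _ _ _.
  have -> : (Normc.normc c ^+ 2)%:C = c * c^*%R by rewrite -normCK normc_def
    rmorphXn.
  have cJ : c^*%R = \sum_(b <- s) (v b)^*%R * v (b * x)%g.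
    rewrite /c innerE rmorph_sum; apply: eq_bigr => b _.
    by rewrite rmorphM; congr (_ * _); exact: conjCK.
  rewrite cJ /c innerE mulr_suml /G; apply: eq_bigr => a _.
  by rewrite mulr_sumr; apply: eq_bigr => b _; ring.
have vva a b : admissible mu (fun x => v (b * x)%g * (v (a * x)%g)^*%R).
  by apply: admissible_mulJ; apply: (admissible_lmul hmu);
    apply: admissible_vector.
have aG : admissible mu G.
  apply: admissible_sum => a; apply: admissible_sum => b.
  exact: admissibleZ.
have innervv : inner mu S v v = \sum_(a <- s) v a * (v a)^*%R.
  have -> : inner mu S v v = inner mu S v (right_translation 1%g v).
    by congr (inner _ _ _ _); apply/funext => g;
      rewrite /right_translation mulg1.
  by rewrite innerE; apply: eq_bigr => a _; rewrite mulg1.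
have intvv : intZG mu (fun x => v x * (v x)^*%R) = V%:C * inner mu S v v.
  rewrite /inner muS /= mulrA -rmorphM mulfV // rmorph1 mul1r.
  by [].
have intG : intZG mu G = V%:C * inner mu S v v ^+ 2.
  rewrite intZG_sum => [|a]; last by apply: admissible_sum => b;
    apply: admissibleZ.
  rewrite expr2 mulrA -intvv mulrC [in RHS]innervv mulr_suml.
  apply: eq_big_seq => a sa.
  rewrite intZG_sum => [|b]; last exact: admissibleZ.
  (* Left translation by a turns v(b x) v(a x)^* into the correlation at b a^-1. For distinct
     representatives b a^-1 is outside S, so only b = a contributes, and each diagonal term carries
     the same integral of |v|^2. *)
  have key b :
      intZG mu (fun x =>
        (v a * (v b)^*%R) * (v (b * x)%g * (v (a * x)%g)^*%R)) =
      (v a * (v b)^*%R) * intZG mu (fun x => v (b * a^-1 * x)%g * (v x)^*%R).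
    rewrite intZG_scale //; congr (_ * _).
    rewrite -(intZG_lmul hmu a (admissible_convolution (b * a^-1)%g));
      congr (intZG _ _).
    by apply/funext => x; rewrite mulgA mulgVK.
  rewrite (bigD1_seq a) //= big1_seq ?addr0.
    rewrite key mulgV; congr (_ * intZG _ _).
    by apply/funext => x; rewrite mul1g.
  move=> b /andP[ba sb]; rewrite key convolution_notin ?mulr0 // => h.
  by rewrite (sinj sa sb h) eqxx in ba.
move=> coeff.
have cE u : (coeff u)%:C = descend G u by rewrite /coeff /descend GE.
have coeffE u : coeff u = complex.Re (descend G u) by rewrite -cE.
split.
  apply: eq_integrable (admissible_integrable aG (@normc_Re R)) => // u _.
  by rewrite coeffE.
have int_re : intZG mu G = (\int[mu]_u coeff u)%:C.
  rewrite /intZG /integralC; apply/eqP; rewrite eq_complex /=; apply/andP;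
    split.
    by apply/eqP/eq_Rintegral => u _; rewrite coeffE.
  apply/eqP; rewrite /Rintegral (eq_integral (cst 0%E));
    first by rewrite integral0.
  by move=> u _; rewrite -cE.
transitivity ((V^-1)%:C * intZG mu G); first by rewrite int_re -rmorphM.
by rewrite intG mulrA -rmorphM mulVf // rmorph1 mul1r.
Qed.

End Vector.

Theorem formal_degree_cInd :
  is_formal_degree mu (cInd S theta) (inner mu S) V^-1.
Proof.
move=> v [vs [C cC vC] vS].
have [s [us sinj sC]] := finite_cosets cC.
by apply: (@formal_degree_vector s) => // g /vC; apply: sC.
Qed.

End InducedCharacter.

(** * The maximal compact subgroup *)

Section Maximal.
Variable F : nonarchLocalFieldType.
Implicit Types (g h k x y z : GSp4 F) (i j l : 'I_4).

(** K described by the multiplier instead of the determinant, in terms of which pairings of columns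
    and inverses are expressed. *)
Definition Kint : set (GSp4 F) :=
  [set g : GSp4 F |
    (forall i j, integers F (g i j)) /\ integer_units F (simil g)].

(** Determinants of g^T J g = mu(g) J. The squared identity suffices to compare valuations. *)
Lemma det_simil g : (\det g) ^+ 2 = simil g ^+ 4.
Proof.
have := congr1 determinant (similP g); rewrite !det_mulmx det_tr detZ => e.
have J0 : \det (Jmx F) != 0.
  have := congr1 determinant (JmxV F); rewrite det_mulmx det1 => e1.
  by apply/eqP => J0; move: e1; rewrite J0 mulr0 => /esym/eqP; rewrite oner_eq0.
by apply: (mulIf J0); rewrite -e; ring.
Qed.

Lemma Kmax_Kint : @Kmax F = Kint.
Proof.
have val_det g : \det g != 0 -> valuation (\det g) * 2 =
  valuation (simil g) * 4.
  move=> d0; have m0 := simil_neq0 g; have := det_simil g.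
  move=> /(congr1 (@valuation F)).
  rewrite !exprS !expr0 !mulr1.
  by rewrite !valuationM ?mulf_neq0 //; lia.
apply/seteqP; split=> g [og [n0 vn]]; split=> //.
  by split; [exact: simil_neq0|have := val_det g n0; lia].
have d0 : \det g != 0.
  have := expf_neq0 4 n0; rewrite -det_simil; apply: contra => /eqP ->.
  by rewrite expr0n.
by split=> //; have := val_det g d0; lia.
Qed.

Lemma KintM g h : Kint g -> Kint h -> Kint (g * h)%g.
Proof.
move=> [og ug] [oh uh]; split; last by rewrite similM; apply: unitM.
by move=> i j; rewrite gsp4_mulE; apply: pideal_sum => l _; apply: integersM.
Qed.

Lemma similV g : simil (g^-1)%g = (simil g)^-1.
Proof.
by apply: (mulIf (simil_neq0 g)); rewrite -similM mulVg simil1 mulVf //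
  simil_neq0.
Qed.

Lemma KintV g : Kint g -> Kint (g^-1)%g.
Proof.
move=> [og ug]; split; last by rewrite similV; apply: unitV.
move=> i j; rewrite gsp4_invij; apply: integersM;
  first exact/unit_integers/unitV.
by apply: integersM => //; apply: integersM; apply: eps_integers.
Qed.

Lemma Kprime_Kint k : Kprime k -> Kint k.
Proof.
move=> kk; split; first by move=> i j; apply: Kprime_integers.
exact/one_units_unit/simil_Kprime.
Qed.

Lemma maxideal_mulB (a b : GSp4 F) h i j : (forall l, integers F (h i l)) ->
  (forall l, maxideal F (a l j - b l j)) ->
  maxideal F ((h * a)%g i j - (h * b)%g i j).
Proof.
move=> oh ab; rewrite !gsp4_mulE -sumrB; apply: pideal_sum => l _.
by rewrite -mulrBr; apply: maxidealMl.
Qed.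

Lemma center_Kint z g : centerG F z -> Kint g -> Kint (z * g)%g ->
  exists2 c, integer_units F c & forall i j, z i j = c * (i == j)%:R.
Proof.
move=> /centerGP[c c0 zE] [_ [_ vg]] [_ [_ vzg]]; exists c => //; split=> //.
move: vzg; rewrite similM (simil_scalar zE) expr2 !valuationM ?mulf_neq0
  ?simil_neq0 // vg; lia.
Qed.

Local Notation "x === y" := (maxideal F (x - y)) (at level 70).

(** The first two columns and the multiplier decide membership in K': pairing column 0 with column j
    gives row 3 modulo p, and pairing columns 1 and 2 then gives g 2 2. *)
Lemma Kint_Kprime g : Kint g -> g 0 0 === 1 -> maxideal F (g 1 0) ->
  maxideal F (g 2 0) -> maxideal F (g 3 0) -> g 1 1 === 1 ->
  maxideal F (g 2 1) -> simil g === 1 -> Kprime g.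
Proof.
move=> [og _] g00 g10 g20 g30 g11 g21 gm.
have row3 j : g 3 j === Jmx F 0 j.
  rewrite (_ : _ - _ = (simil g - 1) * Jmx F 0 j - (g 0 0 - 1) * g 3 j
    - g 1 0 * g 2 j + g 2 0 * g 1 j + g 3 0 * g 0 j); last first.
    by rewrite mulrBl -gsp4_col; ring.
  have oJ : integers F (Jmx F 0 j).
    elim/I4P: j; rewrite mxE /=; do ?[exact: pideal0|exact: integers1].
  apply: pidealD; last by apply: maxidealMr.
  apply: pidealD; last by apply: maxidealMr.
  apply: pidealB; last by apply: maxidealMr.
  by apply: pidealB; apply: maxidealMr.
have g31 : maxideal F (g 3 1) by have := row3 1; rewrite mxE subr0.
have g32 : maxideal F (g 3 2) by have := row3 2; rewrite mxE subr0.
have g33 : g 3 3 === 1 by have := row3 3; rewrite mxE.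
have g22 : g 2 2 === 1.
  have := gsp4_col g 1 2; rewrite mxE /= mulr1 => e.
  rewrite (_ : _ - _ = (simil g - 1) - (g 1 1 - 1) * g 2 2 - g 3 2 * g 0 1 +
    g 2 1 * g 1 2 + g 3 1 * g 0 2); last by rewrite -e; ring.
  apply: pidealD; last by apply: maxidealMr.
  apply: pidealD; last by apply: maxidealMr.
  apply: pidealB; last by apply: maxidealMr.
  by apply: pidealB => //; apply: maxidealMr.
apply/KprimeP => i j; elim/I4P: i; elim/I4P: j; rewrite /wt /= ?subr0 //;
  exact: og.
Qed.

(** Signed permutation matrices of multiplier 1 sending the basis vector 0 to the basis vector i. *)
Definition weyl_mx i : 'M[F]_4 :=
  nth 1%:M [:: 1%:M;
    mx4 [:: [:: 0; 1; 0; 0]; [:: 1; 0; 0; 0]; [:: 0; 0; 0; 1]; [:: 0; 0; 1; 0]];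
    mx4 [:: [:: 0; 1; 0; 0]; [:: 0; 0; 0; -1]; [:: 1; 0; 0; 0]; [:: 0; 0; 1;
      0]];
    mx4 [:: [:: 0; 0; 0; -1]; [:: 0; 1; 0; 0]; [:: 0; 0; 1; 0]; [:: 1; 0; 0;
      0]]] i.

Lemma weyl_mxP i : (weyl_mx i)^T *m Jmx F *m weyl_mx i = 1 *: Jmx F.
Proof.
apply/matrixP => a b; rewrite !mxE sum4 !mxE !sum4 !mxE.
elim/I4P: i; rewrite /weyl_mx /= ?mxE;
  by elim/I4P: a; elim/I4P: b; rewrite /= ?mxE /=; ring.
Qed.

Definition weyl i : GSp4 F := MkGSp4 (is_gsp4_intro (oner_neq0 F) (weyl_mxP i)).

Lemma simil_weyl i : simil (weyl i) = 1.
Proof. by apply: simil_unique; apply: weyl_mxP. Qed.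

Lemma weyl_col i j : weyl i j 0 = (j == i)%:R.
Proof. by elim/I4P: i; elim/I4P: j; rewrite /= /weyl_mx /= mxE. Qed.

Lemma Kint_weyl i : Kint (weyl i).
Proof.
split; last by rewrite simil_weyl; apply: unit1.
move=> a b; elim/I4P: i; elim/I4P: a; elim/I4P: b; rewrite /= /weyl_mx /=
  mxE /=;
  do ?[exact: pideal0|exact: integers1|exact/pidealN/integers1].
Qed.

Lemma Kint_unip r (v : 'I_4 -> F) : (forall i,
  integers F (v i)) -> Kint (unip r v).
Proof.
move=> ov; split; last by rewrite simil_unip; apply: unit1.
have o1 := @integers1 F.
move=> i j; rewrite unipE; do ![case: ifP => // _].
  by apply: integersM => //; apply: integersM; apply: eps_integers.
by case: (i == j); [exact: integers1|exact: pideal0].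
Qed.

(** Completes the second column (0, a, c, 0) to a similitude of multiplier m fixing the basis vector
    0: the middle block must have determinant m. Dividing by a, or by c when a is in p, keeps the
    entries integral. *)
Definition levi_mx (a c m : F) : 'M[F]_4 :=
  let u := if `[< maxideal F a >] then - (m / c) else 0 in
  let d := if `[< maxideal F a >] then 0 else m / a in
  mx4 [:: [:: 1; 0; 0; 0]; [:: 0; a; u; 0]; [:: 0; c; d; 0]; [:: 0; 0; 0; m]].

Lemma levi_mxP a c m : (maxideal F a -> c != 0) ->
  (levi_mx a c m)^T *m Jmx F *m levi_mx a c m = m *: Jmx F.
Proof.
move=> hac; rewrite /levi_mx; case: asboolP => [/hac c0|na].
  apply/matrixP => i j; rewrite !mxE sum4 !mxE !sum4 !mxE.
  by elim/I4P: i; elim/I4P: j => /=; field.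
have a0 : a != 0 by apply/eqP => a0; apply: na; rewrite a0; apply: pideal0.
apply/matrixP => i j; rewrite !mxE sum4 !mxE !sum4 !mxE.
by elim/I4P: i; elim/I4P: j => /=; field.
Qed.

Lemma levi_exists (a c m : F) : integers F a -> integers F c ->
  (maxideal F a -> integer_units F c) -> integer_units F m ->
  exists g, [/\ Kint g, simil g = m, forall i, g i 0 = (i == 0)%:R &
    [/\ g 0 1 = 0, g 1 1 = a, g 2 1 = c & g 3 1 = 0]].
Proof.
move=> oa oc hac um.
have hac0 : maxideal F a -> c != 0 by move=> /hac /unit_neq0.
pose g : GSp4 F := MkGSp4 (is_gsp4_intro (unit_neq0 um) (levi_mxP m hac0)).
have gm : simil g = m by apply: simil_unique; apply: levi_mxP.
exists g; split=> //; last by split; rewrite mxE.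
- split; last by rewrite gm.
  have := @integers1 F; have := unit_integers um; have p0 := @pideal0 F 0.
  have [pa|na] := asboolP (maxideal F a).
    have cm : integers F (- (m / c)).
      by apply: pidealN; apply: integersM; apply: unit_integers => //;
        apply/unitV/hac.
    move=> om o1 i j; rewrite /= /levi_mx asboolT // mxE.
    by elim/I4P: i; elim/I4P: j.
  have am : integers F (m / a).
    apply: integersM; apply: unit_integers => //; apply/unitV.
    exact: unit_notin_maxideal.
  move=> om o1 i j; rewrite /= /levi_mx asboolF // mxE.
  by elim/I4P: i; elim/I4P: j.
- by move=> i; rewrite mxE; elim/I4P: i.
Qed.

End Maximal.

(** * Representatives of K modulo Z(o) K' *)

Section Cosets.
Variables (F : nonarchLocalFieldType) (q : nat) (r : 'I_q -> F).
Hypotheses (ro : forall i, integers F (r i))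
  (rx : forall x, integers F x -> exists i, maxideal F (x - r i))
  (rinj : forall i j, maxideal F (r i - r j) -> i = j).
Variable z0 : 'I_q.
Hypothesis rz0 : maxideal F (r z0).
Implicit Types (g h k z : GSp4 F) (v : {ffun 'I_4 -> 'I_q}).
Local Notation "x === y" := (maxideal F (x - y)) (at level 70).

Lemma cong_sym (x y : F) : x === y -> y === x.
Proof. by rewrite -opprB => /pidealN; rewrite opprK. Qed.

Lemma cong_trans (x y w : F) : x === y -> y === w -> x === w.
Proof. by move=> xy yw; rewrite -(subrKA y); apply: pidealD. Qed.

Lemma congM (x x' y y' : F) : integers F x -> integers F y' ->
  x === x' -> y === y' -> x * y === x' * y'.
Proof.
move=> ox oy xx yy; rewrite (_ : _ - _ = x * (y - y') + (x - x') * y');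
  last by ring.
by apply: pidealD; [apply: maxidealMl|apply: maxidealMr].
Qed.

Lemma cong_maxideal (x y : F) : x === y -> maxideal F y -> maxideal F x.
Proof. by move=> xy py; rewrite -(subrK y x); apply: pidealD. Qed.

Lemma r_maxideal i : maxideal F (r i) <-> i = z0.
Proof.
split=> [ri|->//]; apply: rinj; exact: pidealB.
Qed.

Lemma r_unit i : i != z0 -> integer_units F (r i).
Proof.
by move=> /eqP iz; apply: unit_notin_maxideal => // /r_maxideal.
Qed.

(** Depends only on the support of v, hence is the same for proportional residue vectors. *)
Definition lead v : 'I_4 := odflt 0 [pick i | v i != z0].

Lemma leadP v : v != [ffun=> z0] -> v (lead v) != z0.
Proof.
rewrite /lead; case: pickP => //= h /eqP[]; apply/ffunP => i; rewrite ffunE.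
by apply/eqP; have := h i; case: eqP.
Qed.

Lemma lead_ext v v' : (forall i, (v i != z0) = (v' i != z0)) -> lead v =
  lead v'.
Proof. by move=> h; rewrite /lead (eq_pick h). Qed.

Definition col_rep v (i : 'I_4) : F := r (v i) / r (v (lead v)).

(** An integral element of multiplier 1 whose first column is v scaled to leading entry 1. *)
Definition nrep v : GSp4 F := (unip (lead v) (col_rep v) * weyl F (lead v))%g.

Lemma nrep_col v i : v != [ffun=> z0] -> nrep v i 0 = col_rep v i.
Proof.
move=> /leadP/r_unit/unit_neq0 s0; rewrite gsp4_mulE.
under eq_bigr => l _ do rewrite weyl_col mulrC.
rewrite sum_delta unipE eqxx; case: eqVneq => // ->.
by rewrite /col_rep divff.
Qed.

Lemma simil_nrep v : simil (nrep v) = 1.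
Proof. by rewrite similM simil_unip simil_weyl mulr1. Qed.

Lemma col_rep_integers v i : v != [ffun=> z0] -> integers F (col_rep v i).
Proof.
by move=> /leadP/r_unit us; apply: integersM => //; apply/unit_integers/unitV.
Qed.

Lemma Kint_nrep v : v != [ffun=> z0] -> Kint (nrep v).
Proof.
move=> hv; apply: KintM (Kint_weyl _ _); apply: Kint_unip => i.
exact: col_rep_integers.
Qed.

Lemma col_rep_maxideal v i : v != [ffun=> z0] ->
  maxideal F (col_rep v i) <-> v i = z0.
Proof.
move=> /leadP/r_unit us; rewrite -r_maxideal /col_rep mulrC; split.
  by move/maxideal_mul_unit; apply; apply: unitV.
by move=> h; apply: maxidealMl => //; apply/unit_integers/unitV.
Qed.

Local Notation index := ({ffun 'I_4 -> 'I_q} * ('I_q * 'I_q))%type.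
Implicit Type u : index.

(** A nonzero residue vector of length 4, carrying the line of the first column and the multiplier,
    and a nonzero pair for the second column modulo the first. *)
Definition valid u := (u.1 != [ffun=> z0]) && (u.2 != (z0, z0)).

Definition levi_spec u g := [/\ Kint g, simil g = r (u.1 (lead u.1)),
  forall i, g i 0 = (i == 0)%:R &
  [/\ g 0 1 = 0, g 1 1 = r u.2.1, g 2 1 = r u.2.2 & g 3 1 = 0]].

(** Validity sits under the existential so that the axiom of choice yields a function on all
    indices. *)
Lemma mrep_exists u : exists g, valid u -> levi_spec u g.
Proof.
have [/andP[/leadP hv /eqP hac]|_] := boolP (valid u); last by exists 1%g.
have [|g hg] := @levi_exists F (r u.2.1) (r u.2.2) (r (u.1 (lead u.1))) (ro _)
  (ro _) _ (r_unit hv).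
  move=> /r_maxideal a0; apply: r_unit; apply/eqP => c0; apply: hac.
  by case: u.2 a0 c0 => a c /= -> ->.
by exists g.
Qed.

Variable mrep : index -> GSp4 F.
Hypothesis mrepP : forall u, valid u -> levi_spec u (mrep u).

(* The multiplier of [rho u] is the leading entry of the vector [u.1] whose line
   is spanned by the first column: the scalar lost when passing from a vector to
   its line is put back into the multiplier, which makes [rho] injective modulo
   the center. *)
Definition rho u : GSp4 F := (nrep u.1 * mrep u)%g.

Lemma Kint_rho u : valid u -> Kint (rho u).
Proof.
move=> hu; have [km _ _ _] := mrepP hu; case/andP: hu => hv _.
by apply: KintM => //; apply: Kint_nrep.
Qed.

Lemma simil_rho u : valid u -> simil (rho u) = r (u.1 (lead u.1)).
Proof. by move=> hu; rewrite similM simil_nrep mul1r; case: (mrepP hu). Qed.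

Lemma rho_col u i : valid u -> rho u i 0 = col_rep u.1 i.
Proof.
move=> hu; have [_ _ m0 _] := mrepP hu; case/andP: hu => hv _.
rewrite -nrep_col // gsp4_mulE.
under eq_bigr => l _ do rewrite m0 mulrC.
by rewrite sum_delta.
Qed.

(** Modulo p, K' is upper unipotent: it fixes the first column and adds to the second a multiple of
    the first. *)
Lemma mul_Kprime_col g k (i j : 'I_4) : Kint g -> Kprime k -> (j <= 1)%N ->
  (g * k)%g i j === g i j + (j == 1)%:R * (g i 0 * k 0 1).
Proof.
move=> [og _] kk j1; rewrite gsp4_mulE sum4.
have ok := Kprime_integers _ _ kk; have lk := Kprime_low kk; have dk :=
  Kprime_diag _ kk.
have {j1} [->|->] : j = 0 \/ j = 1.
  by move: j1; elim/I4P: j => // _; [left|right].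
  rewrite mul0r addr0 (_ : _ - _ = g i 0 * (k 0 0 - 1) + g i 1 * k 1 0 +
    g i 2 * k 2 0 + g i 3 * k 3 0); last by ring.
  by do ?[apply: pidealD]; apply: maxidealMl => //; apply: lk.
rewrite mul1r (_ : _ - _ = g i 1 * (k 1 1 - 1) +
  g i 2 * k 2 1 + g i 3 * k 3 1); last by ring.
by do ?[apply: pidealD]; apply: maxidealMl => //; apply: lk.
Qed.

Lemma rho_inj u u' : valid u -> valid u' -> Hgrp ((rho u)^-1 * rho u')%g -> u =
  u'.
Proof.
move=> hu hu' [z [k [cz kk e]]].
have e' : rho u' = (z * (rho u * k))%g by rewrite mulgA (cz (rho u)) -mulgA -e
  mulVKg.
have K1 := KintM (Kint_rho hu) (Kprime_Kint kk).
have K2 := Kint_rho hu'; rewrite e' in K2.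
have [c uc zE] := center_Kint cz K1 K2.
have zM g := scalar_mulE g zE.
have [/andP[hv _] /andP[hv' _]] := (hu, hu').
have oc := unit_integers uc.
have colE i : col_rep u'.1 i === c * col_rep u.1 i.
  rewrite -rho_col // e' zM -rho_col //; rewrite -mulrBr; apply: maxidealMl =>
    //.
  by have := mul_Kprime_col i (j := 0) (Kint_rho hu) kk isT;
    rewrite mul0r addr0.
have supp i : (u.1 i != z0) = (u'.1 i != z0).
  congr (~~ _); apply/eqP/eqP => /(col_rep_maxideal i) h.
    apply/(col_rep_maxideal i hv'); apply: cong_maxideal (colE i) _.
    by apply: maxidealMl => //; apply: h.
  apply/(col_rep_maxideal i hv)/(maxideal_mul_unit uc).
  exact: cong_maxideal (cong_sym (colE i)) (h hv').
have leadE := lead_ext supp.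
(* Both normalized columns have leading entry 1 at the same place. *)
have c1 : 1 === c.
  have := colE (lead u.1); rewrite {1}leadE /col_rep !divff ?mulr1 //.
    exact/unit_neq0/r_unit/leadP.
  exact/unit_neq0/r_unit/leadP.
(* Comparison of multipliers, now that c^2 and the multiplier of k are 1 modulo p; it recovers the
   scale of the vector from its line. *)
have sE : r (u'.1 (lead u'.1)) === r (u.1 (lead u.1)).
  rewrite -!simil_rho // e' (similM z) (similM (rho u)) mulrC.
  rewrite (simil_scalar zE) expr2.
  have gr : integers F (simil (rho u)) by apply: unit_integers;
    case: (Kint_rho hu).
  rewrite -[X in _ === X]mulr1 -mulrA.
  have ogk : integers F (simil k) by
    apply/unit_integers/one_units_unit/simil_Kprime.
  have o1 := @integers1 F; have c1' := cong_sym c1.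
  apply: (congM gr o1); first by rewrite subrr; apply: pideal0.
  rewrite -[X in _ === X]mulr1; apply: (congM ogk o1);
    first exact: simil_Kprime.
  by rewrite -[X in _ === X]mulr1; apply: (congM oc o1).
have sI := rinj sE; have us := r_unit (leadP hv).
have vE : u.1 = u'.1.
  apply/ffunP => i; apply: rinj; apply: cong_sym.
  have := colE i; rewrite /col_rep sI => h.
  apply: (maxideal_mul_unit (unitV us)); rewrite mulrBr mulrC [X in _ - X]mulrC.
  apply: cong_trans h _; rewrite -[X in _ === X]mul1r; apply: congM => //.
  - by apply: integersM => //; apply/unit_integers/unitV.
  - exact: cong_sym.
  - by rewrite subrr; apply: pideal0.
have mE : mrep u' = (z * (mrep u * k))%g.
  apply: (mulgI (nrep u.1)); rewrite {1}vE -/(rho u') e' /rho.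
  by rewrite [RHS]mulgA -(cz (nrep u.1)) !mulgA.
have [km gm m0 [m01 m11 m21 m31]] := mrepP hu.
have [_ _ _ [m01' m11' m21' m31']] := mrepP hu'.
have acE i : i != 0 -> mrep u' i 1 === mrep u i 1.
  move=> i0; rewrite mE zM.
  have h := mul_Kprime_col i (j := 1) km kk isT.
  rewrite m0 (negPf i0) mul0r mulr0 addr0 in h.
  have om : integers F (mrep u i 1) by case: km.
  by rewrite -[X in _ === X]mul1r; apply: congM => //; apply: cong_sym.
have aE := acE 1 isT; have cE := acE 2 isT.
rewrite m11 m11' in aE; rewrite m21 m21' in cE.
move: vE (rinj aE) (rinj cE); case: (u) (u') => [v [a c']] [v' [a' c'']] /=.
by move=> -> -> ->.
Qed.

Lemma rho_surj g : Kint g -> exists2 u, valid u & Hgrp ((rho u)^-1 * g)%g.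
Proof.
move=> kg; have [og ug] := kg.
pose p i := ~~ `[< maxideal F (g i 0) >].
have [i0 pi0] : exists i, p i.
  apply: contrapT => h; have gp i : maxideal F (g i 0).
    by apply: contrapT => ng; apply: h; exists i; apply/negP => /asboolP.
  apply: (maxideal_unit ug).
  have := gsp4_col g 0 3; rewrite [Jmx F 0 3]mxE /= mulr1 => <-.
  apply: pidealB; last exact: maxidealMr.
  apply: pidealB; last exact: maxidealMr.
  by apply: pidealD; apply: maxidealMr.
pose l := odflt 0 [pick i | p i].
have pl : p l by rewrite /l; case: pickP => //= h; rewrite h in pi0.
have ul : integer_units F (g l 0).
  by apply: unit_notin_maxideal => //; apply/asboolPn.
have [z cz zE] := center_scalar (unit_neq0 ul).
pose c := g l 0.
have zVg := scalar_mulVE g (unit_neq0 ul) zE.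
pose y := (z^-1 * g)%g.
have ky : Kint y.
  split; first by move=> i j; rewrite zVg; apply: integersM => //;
    apply/unit_integers/unitV.
  by rewrite similM similV (simil_scalar zE) expr2; apply: unitM => //;
    apply: unitV; apply: unitM.
have y_l : y l 0 = 1 by rewrite zVg divff // (unit_neq0 ul).
have [oy uy] := ky; pose s := simil y.
(* The column scaled to leading entry 1 is multiplied by the multiplier s, so that the leading entry
   of v is s, as [levi_spec] demands. *)
have /choice[v' v'P] : forall i, exists j, s * y i 0 === r j.
  by move=> i; apply: rx; apply: integersM => //; apply: unit_integers.
pose v : {ffun 'I_4 -> 'I_q} := [ffun i => v' i].
have vP i : s * y i 0 === r (v i) by rewrite ffunE.
have supp i : (v i != z0) = p i.
  apply/idP/idP => [vi|pi].
    apply/negP => /asboolP gp; move/eqP: vi; apply; apply/r_maxideal.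
    apply: cong_maxideal (cong_sym (vP i)) _; apply: maxidealMl.
      exact: unit_integers.
    by rewrite zVg; apply: maxidealMr => //; apply/unit_integers/unitV.
  apply/negP => /eqP /r_maxideal rp; move/negP: pi; apply; apply/asboolP.
  have := cong_maxideal (vP i) rp => /(maxideal_mul_unit uy).
  by rewrite zVg mulrC => /maxideal_mul_unit; apply; apply: unitV.
have lv : lead v = l by rewrite /lead (eq_pick supp).
have hv : v != [ffun=> z0].
  apply/eqP => v0; have := supp l; rewrite pl v0 ffunE eqxx //.
have us := r_unit (leadP hv).
have sr : s === r (v (lead v)) by have := vP l; rewrite y_l mulr1 lv.
have colE i : y i 0 === nrep v i 0.
  rewrite nrep_col // /col_rep; apply: (maxideal_mul_unit us).
  rewrite mulrBr mulrCA divff ?(unit_neq0 us) // mulr1.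
  apply: cong_trans (vP i).
  by apply: congM => //; [exact: cong_sym|rewrite subrr; apply: pideal0].
have kn := Kint_nrep hv.
pose g1 := ((nrep v)^-1 * y)%g.
have kg1 : Kint g1 by apply: KintM => //; apply: KintV.
have [og1 _] := kg1.
have g1c i : g1 i 0 === (i == 0)%:R.
  rewrite -gsp4_oneE -(mulVg (nrep v)); apply: maxideal_mulB => // l'.
  by case: (KintV kn).
have g1m : simil g1 = s by rewrite similM similV simil_nrep invr1 mul1r.
have p10 : maxideal F (g1 1 0) by have := g1c 1; rewrite subr0.
have p20 : maxideal F (g1 2 0) by have := g1c 2; rewrite subr0.
have p30 : maxideal F (g1 3 0) by have := g1c 3; rewrite subr0.
have p00 : g1 0 0 === 1 by have := g1c 0.
have row3 j : j != 3 -> maxideal F (g1 3 j).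
  move=> j3; have u00 := one_units_unit p00; apply: (maxideal_mul_unit u00).
  have := gsp4_col g1 0 j; rewrite Jmx_neq ?mulr0; last first.
    by rewrite (_ : rev_ord 0 = 3) //; apply: val_inj.
  move=> e1; rewrite -[_ * _]subr0 -e1.
  rewrite (_ : _ - _ = - (g1 1 0 * g1 2 j) + g1 2 0 * g1 1 j + g1 3 0 * g1 0
    j); last by ring.
  apply: pidealD; last exact: maxidealMr.
  apply: pidealD; last exact: maxidealMr.
  by apply: pidealN; apply: maxidealMr.
have [a aP] := rx (og1 1 1); have [b bP] := rx (og1 2 1).
(* Otherwise the pairing of columns 1 and 2, which is the unit multiplier, would lie in p. *)
have hab : (a, b) != (z0, z0).
  apply/eqP => -[a0 b0]; apply: (maxideal_unit uy); rewrite -/s -g1m.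
  have pa := cong_maxideal aP; have pb := cong_maxideal bP.
  have := gsp4_col g1 1 2; rewrite [Jmx F 1 2]mxE /= mulr1 => <-.
  apply: pidealB; last by apply: maxidealMr => //; apply: row3.
  apply: pidealB; last by apply: maxidealMr => //; apply: pb; rewrite b0.
  apply: pidealD; first by apply: maxidealMl => //; apply: row3.
  by apply: maxidealMr => //; apply: pa; rewrite a0.
pose u : index := (v, (a, b)).
have hu : valid u by apply/andP.
exists u => //; have [km gm m0 [m01 m11 m21 m31]] := mrepP hu.
exists z, ((mrep u)^-1 * g1)%g; split=> //; last first.
  rewrite /rho invgM /g1 /y /= !mulgA; congr (_ * _)%g.
  by rewrite -(mulgA z) (cz (_ * _)%g) mulgK.
set h := ((mrep u)^-1 * g1)%g.
have kh : Kint h by apply: KintM => //; apply: KintV.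
have omV l' i : integers F ((mrep u)^-1%g i l') by case: (KintV km).
have hc i : h i 0 === (i == 0)%:R.
  rewrite -gsp4_oneE -(mulVg (mrep u)); apply: maxideal_mulB => // j.
  by rewrite m0; apply: g1c.
(* The (0,1) entry stays free, as K' only asks it to be integral. *)
have hc1 i : h i 1 === (i == 1)%:R + g1 0 1 * (i == 0)%:R.
  have mV0 : (mrep u)^-1%g i 0 = (i == 0)%:R.
    have := gsp4_mulE (mrep u)^-1%g (mrep u) i 0; rewrite mulVg gsp4_oneE => ->.
    under eq_bigr => j _ do rewrite m0 mulrC.
    by rewrite sum_delta.
  have mV1 : \sum_j (mrep u)^-1%g i j * mrep u j 1 = (i == 1)%:R.
    by rewrite -gsp4_mulE mulVg gsp4_oneE.
  rewrite -mV1 /h gsp4_mulE !sum4 m01 m11 m21 m31 mV0.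
  rewrite (_ : _ - _ = (mrep u)^-1%g i 1 * (g1 1 1 - r a) +
    (mrep u)^-1%g i 2 * (g1 2 1 - r b) + (mrep u)^-1%g i 3 * g1 3 1);
      last by ring.
  do ?[apply: pidealD]; apply: maxidealMl => //; exact: row3.
have hm : simil h === 1.
  rewrite similM similV gm g1m; apply: (maxideal_mul_unit us).
  by rewrite mulrBr mulrA divff ?(unit_neq0 us) // mul1r mulr1.
have h00 : h 0 0 === 1 by have := hc 0.
have h10 : maxideal F (h 1 0) by have := hc 1; rewrite subr0.
have h20 : maxideal F (h 2 0) by have := hc 2; rewrite subr0.
have h30 : maxideal F (h 3 0) by have := hc 3; rewrite subr0.
have h11 : h 1 1 === 1 by have := hc1 1; rewrite mulr0 addr0.
have h21 : maxideal F (h 2 1) by have := hc1 2; rewrite mulr0 addr0 subr0.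
exact: Kint_Kprime.
Qed.

Lemma card_valid : #|[pred u | valid u]| = ((q ^ 4 - 1) * (q ^ 2 - 1))%N.
Proof.
pose A : {pred {ffun 'I_4 -> 'I_q}} := predC1 [ffun=> z0].
pose B : {pred 'I_q * 'I_q} := predC1 (z0, z0).
have -> : #|[pred u | valid u]| = #|[pred u : index | (u.1 \in A) && (u.2 \in
  B)]|.
  by apply: eq_card => u; rewrite !inE.
by rewrite cardX !cardC1 card_ffun card_prod !card_ord -!subn1 mulnn.
Qed.

End Cosets.

(** * Volumes *)

Section Volume.
Variables (R : realType) (F : nonarchLocalFieldType) (q : nat).
Hypothesis hq : residue_field F #= `I_q.
Variables (mu : {measure set (borelZG F) -> \bar R}) (hmu : haar_measure mu).
Hypothesis hmuK : mu (@piZ F @` mulset (centerG F) (@Kmax F)) = 1%E.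
Implicit Types (g h k z : GSp4 F).

Lemma mu_disjoint_union (I : choiceType) (s : seq I) (A : I -> set (borelZG F))
    (c : \bar R) : uniq s -> (forall i, measurable (A i)) ->
  {in s &, forall i j u, A i u -> A j u -> i = j} ->
  {in s, forall i, mu (A i) = c} ->
  mu (\big[setU/set0]_(i <- s) A i) = (c *+ size s)%R.
Proof.
move=> + mA; elim: s => [_ _ _|i s IHs /= /andP[is_ us] inj hc].
  by rewrite big_nil measure0 mulr0n.
have mB : measurable (\big[setU/set0]_(j <- s) A j) by apply:
  bigsetU_measurable.
have dis : A i `&` \big[setU/set0]_(j <- s) A j = set0.
  rewrite -bigcup_seq; apply/seteqP; split=> // u [Ai [j /= js Aj]].
  have ij : i = j by apply: (inj i j) Ai Aj; rewrite ?inE ?eqxx // js orbT.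
  by rewrite ij js in is_.
rewrite big_cons measureU //.
rewrite mulrS; congr (_ + _)%E; first by apply: hc; rewrite inE eqxx.
apply: IHs => //; first by move=> a b sa sb; apply: inj;
  rewrite inE ?sa ?sb orbT.
by move=> a sa; apply: hc; rewrite inE sa orbT.
Qed.

Lemma residue_q_gt0 : (0 < q)%N.
Proof.
have [r [_ rx _]] := residue_representatives hq.
by have [[i iq] _] := rx 0 (pideal0 _ 0); apply: leq_trans iq.
Qed.

Lemma measurable_Hgrp_coset a :
  measurable (@piZ F @` [set g | Hgrp (a * g)%g] : set (borelZG F)).
Proof.
apply: measurable_piZ; last by apply: open_ltranslate; apply: open_Hgrp.
move=> z g cz; apply/propext => /=.
by rewrite mulgA -(cz a) -mulgA (Zinvariant_Hgrp _ cz).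
Qed.

Lemma mu_Hgrp_coset a :
  mu (@piZ F @` [set g | Hgrp (a * g)%g]) = mu (@piZ F @` @Hgrp F).
Proof.
by apply: mu_ltranslate => //; [exact: Zinvariant_Hgrp|exact: open_Hgrp].
Qed.

(** The left translates of H by the [rho u] partition ZK modulo Z: surjectivity gives the cover,
    injectivity the disjointness, left invariance the equal volumes. *)
Lemma mu_Hgrp_mulrn :
  (mu (@piZ F @` @Hgrp F) *+ ((q ^ 4 - 1) * (q ^ 2 - 1)))%R = 1%E.
Proof.
have [r [ro rx rinj]] := residue_representatives hq.
have [z0 hz0] := rx 0 (pideal0 _ 0).
have rz0 : maxideal F (r z0) by move: hz0; rewrite sub0r => /pidealN;
  rewrite opprK.
have [mrep mrepP] := choice (mrep_exists ro rinj rz0).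
rewrite -hmuK Kmax_Kint -(card_valid z0).
set T := [pred u | valid z0 u]; rewrite cardE.
pose A u : set (borelZG F) := @piZ F @` [set g | Hgrp ((rho r z0 mrep u)^-1 *
  g)%g].
rewrite -(@mu_disjoint_union _ (enum T) A) //.
- congr (mu _); rewrite -bigcup_seq; apply/seteqP; split=> x.
    move=> [u /=]; rewrite mem_enum inE => hu [g [z [k [cz kk e]]] <-].
    exists (z * (rho r z0 mrep u * k))%g.
      exists z, (rho r z0 mrep u * k)%g; split=> //; apply: KintM.
        exact: (Kint_rho ro rinj rz0 mrepP).
      exact: Kprime_Kint.
    congr piZ; rewrite mulgA (cz (rho _ _ _ _)) -mulgA -e mulVKg //.
  move=> [g [z [k [cz kk ->]]] <-]; rewrite (piZ_center _ cz).
  have [u hu hk] := rho_surj ro rx rinj rz0 mrepP kk.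
  by exists u; [rewrite /= mem_enum inE|exists k].
- exact: enum_uniq.
- by move=> u; apply: measurable_Hgrp_coset.
- move=> u u'; rewrite !mem_enum !inE => hu hu' x.
  move=> [g hg <-] [h hh /piZP[z cz e]].
  apply: (rho_inj ro rinj rz0 mrepP hu hu').
  have hg' : Hgrp ((rho r z0 mrep u)^-1 * (z^-1 * g))%g.
    move: hg => /= hg.
    have -> : ((rho r z0 mrep u)^-1 * (z^-1 * g) =
      z^-1 * ((rho r z0 mrep u)^-1 * g))%g.
      by rewrite !mulgA (centerV cz).
    by apply: HgrpM hg; apply/center_Hgrp/centerV.
  move: hg'; rewrite e mulKg => hg'.
  by have := HgrpM hg' (HgrpV hh); rewrite (invgM _ h) invgK mulgA mulgK.
- by move=> u _; apply: mu_Hgrp_coset.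
Qed.

(** N times the volume being 1 excludes both an infinite volume and N = 0, so the nonvanishing of N
    comes from the same identity. *)
Lemma mu_Hgrp :
  mu (@piZ F @` @Hgrp F) = (((q%:R ^+ 4 - 1) * (q%:R ^+ 2 - 1))^-1)%:E
  /\ (q%:R ^+ 4 - 1) * (q%:R ^+ 2 - 1) != 0 :> R.
Proof.
have := mu_Hgrp_mulrn; set N := (_ * _)%N.
have NE : N%:R = (q%:R ^+ 4 - 1) * (q%:R ^+ 2 - 1) :> R.
  by rewrite natrM !natrB ?expn_gt0 ?residue_q_gt0 // !natrX.
rewrite -NE.
have : (0 <= mu (@piZ F @` @Hgrp F))%E by [].
case: (mu _) => [x _|_|//].
  have natmulE n : (x%:E *+ n)%R = (x *+ n)%:E.
    by elim: n => // n IHn; rewrite !mulrS IHn.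
  rewrite natmulE => -[xN].
  have {}xN : x * N%:R = 1 by rewrite mulr_natr.
  have N0 : N%:R != 0 :> R.
    by apply/eqP => N0; move: xN; rewrite N0 mulr0 => /esym/eqP;
      rewrite oner_eq0.
  by split=> //; congr (_%:E); apply: (mulIf N0); rewrite xN mulVf.
case: N NE => [_|n _]; first by rewrite mulr0n => -[] /esym/eqP;
  rewrite oner_eq0.
suff -> : ((+oo%E : \bar R) *+ n.+1)%R = +oo%E by [].
by elim: n => // n IHn; rewrite mulrS IHn.
Qed.

Lemma mu_Hprime varpi t : uniformizer varpi -> integer_units F t ->
  mu (@piZ F @` Hprime varpi t) =
  (((q%:R ^+ 4 - 1) * (q%:R ^+ 2 - 1) / 2)^-1)%:E.
Proof.
move=> hvarpi ht; have [muH N0] := mu_Hgrp.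
have -> : @piZ F @` Hprime varpi t = (@piZ F @` @Hgrp F) `|`
    (@piZ F @` [set g | Hgrp ((gchi varpi t)^-1 * g)%g]).
  apply/seteqP; split=> x.
    by move=> [g /HprimeP[hg|hg] <-]; [left|right]; exists g.
  by move=> [[g hg <-]|[g hg <-]]; exists g => //; apply/HprimeP; [left|right].
rewrite measureU /=.
- rewrite mu_Hgrp_coset muH -EFinD; congr (_%:E).
  set N := _ * _ in N0 *.
  have ZN : (2 : R) != 0 by rewrite pnatr_eq0.
  by field; rewrite N0.
- by apply: measurable_piZ; [exact: Zinvariant_Hgrp|exact: open_Hgrp].
- exact: measurable_Hgrp_coset.
apply/seteqP; split=> // x [[g hg <-] [h hh /piZP[z cz e]]].
apply: (gchi_notin hvarpi ht).
have hh' : Hgrp h.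
  rewrite -(mulKg z h) -e.
  by apply: HgrpM hg; apply/center_Hgrp/centerV.
have := HgrpM hh' (HgrpV hh); rewrite invgM invgK mulgA mulgV mul1g //.
Qed.

End Volume.

Theorem proposition3p1 (R : realType) (F : nonarchLocalFieldType)
    (q : nat) (hq : residue_field F #= `I_q)
    (varpi : F) (hvarpi : uniformizer varpi)
    (psi : F -> R[i]) (hpsi : additive_character psi)
    (hpsi_o : forall x, integers F x -> psi x = 1)
    (hpsi_p : exists2 x, pideal F (- 1) x & psi x != 1)
    (t : F) (ht : integer_units F t)
    (mu : {measure set (borelZG F) -> \bar R}) (hmu : haar_measure mu)
    (hmuK : mu (@piZ F @` mulset (centerG F) (@Kmax F)) = 1%E)
    (s : bool) :
  is_formal_degree mu
    (cInd (Hprime varpi t) (chi_pm psi varpi t s))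
    (inner mu (Hprime varpi t))
    ((q%:R ^+ 4 - 1) * (q%:R ^+ 2 - 1) / 2).
Proof.
have [_ N0] := mu_Hgrp hq hmu hmuK.
(* The general theorem gives the degree as the inverse of a volume. *)
rewrite -[X in is_formal_degree _ _ _ X]invrK.
have center_chi z : centerG F z -> chi_pm psi varpi t s z = 1.
  move=> cz; rewrite chi_pmH; last exact: center_Hgrp.
  exact: (chi_center hvarpi hpsi hpsi_o ht).
apply: formal_degree_cInd => //.
- apply: open_subgroup => [g h|k kk]; first exact: (HprimeM hvarpi ht).
  exact/Hprime_Hgrp/Kprime_Hgrp.
- by move=> z cz; apply/Hprime_Hgrp/center_Hgrp.
- by move=> g h; apply: (HprimeM hvarpi ht).
- by move=> g; apply: (HprimeV hvarpi ht).
- by move=> g; apply: (chi_pm_norm hvarpi hpsi hpsi_o ht s hq).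
- by rewrite invr_eq0 mulf_neq0 // invr_eq0 pnatr_eq0.
- exact: mu_Hprime.
(* By contraposition: if no k separates the two characters, then y intertwines chi on K', hence lies
   in H'. *)
move=> y ny; apply: contrapT => h; apply: ny.
apply: (intertwines_Hprime hvarpi hpsi hpsi_o hpsi_p ht) => k kk ky.
apply: contrapT => neq; apply: h; exists k.
have [hk hky] := (Kprime_Hgrp kk, Kprime_Hgrp ky).
split; [exact: Hprime_Hgrp|exact: Hprime_Hgrp|].
by rewrite !chi_pmH //; apply/eqP.
Qed.
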